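(* For each $t \in \mathbb{Z}[\frac12]$ with $t>-1$ and all $G,H \in \widetilde{\mathbb{G}}$, the following hold: 1. If $G \geq H$, then $G_t \geq H_t$. 2. If $G \rhd\!| H$ (i.e. $G\not\le H$), then $G_t \rhd\!| H_t-t$ (i.e. $G_t\not\le H_t-t$).
   Context: Games. $\widetilde{\mathbb{G}}$ is the set of all formal (short, i.e. finite loopfree) normal-play partizan games $G=\{G^L\mid G^R\}$, where $G^L$ (resp. $G^R$) ranges over the finitely many Left (resp. Right) options of $G$; $\tilde b(G)$ is the formal birthday (height of the game tree). Sums and negatives of games are the usual ones; $G\ge 0$ means Left wins $G$ moving second under normal play, $G\ge H$ means $G-H\ge 0$, and $G$ is equal to $H$ (equality of game values) if $G\ge H$ and $H\ge G$. $G\rhd\!| H$ means $G\not\le H$. The dyadic rationals $\mathbb{Z}[\frac12]$ are identified in the usual way with the numbers among game values; ''equal to an integer/number'' means having such a game value. When a dyadic rational is used as a formal game, its canonical form is meant. Cooling and temperature. For $G\in\widetilde{\mathbb{G}}$ and $t\in\mathbb{Z}[\frac12]$, define $\lambda_t(G),\rho_t(G)\in\mathbb{Z}[\frac12]$, $G_t\in\widetilde{\mathbb{G}}$ and $t(G)\in\mathbb{Z}[\frac12]\cup\{-\infty\}$ by recursion on $\tilde b(G)$ (this recursion is well-defined): - If $G$ is equal to an integer $n$: $\lambda_t(G)=\rho_t(G)=n$, $G_t=n$ (canonical form), $t(G)=-\infty$. - Otherwise let $\widetilde{\lambda}_t(G)=\max_{G^L}\{\rho_t(G^L)-t\}$,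 $\widetilde{\rho}_t(G)=\min_{G^R}\{\lambda_t(G^R)+t\}$, $\widetilde{G}_t=\{(G^L)_t-t\mid (G^R)_t+t\}$ (with all $G^L$, $G^R$), and $t(G)=\min\{t\in\mathbb{Z}[\frac12]\mid \widetilde{\lambda}_t(G)=\widetilde{\rho}_t(G)\}$. If $t\le t(G)$, set $\lambda_t(G)=\widetilde{\lambda}_t(G)$, $\rho_t(G)=\widetilde{\rho}_t(G)$, $G_t=\widetilde{G}_t$. If $t>t(G)$, set $\lambda_t(G)=\rho_t(G)=x$ and $G_t=x$ (canonical form), where $x=\lambda_{t(G)}(G)=\rho_{t(G)}(G)$. *)

(* Defs.v *)
From mathcomp Require Import all_boot all_order all_algebra.
From mathcomp Require Import boolp classical_sets.
Set Implicit Arguments.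
Unset Strict Implicit.
Unset Printing Implicit Defensive.
Import Order.TTheory GRing.Theory Num.Theory.
Local Open Scope ring_scope.

(* Option sets are represented by lists; nothing below depends on the order or
   the multiplicity of the options. *)
Inductive game : Type := Game of seq game & seq game.

Fixpoint game_opp (G : game) : game :=
  let: Game GL GR := G in Game (map game_opp GR) (map game_opp GL).

Fixpoint game_add (G : game) : game -> game :=
  let: Game GL GR := G in
  fix add_G (H : game) : game :=
    let: Game HL HR := H in
    Game ([seq game_add X H | X <- GL] ++ [seq add_G Y | Y <- HL])
         ([seq game_add X H | X <- GR] ++ [seq add_G Y | Y <- HR]).

Definition game_sub (G H : game) : game := game_add G (game_opp H).

(* Left has a winning strategy in normal play; the boolean is true when it is
   Left's turn to move, and false when it is Right's. *)
Fixpoint left_wins (left_to_move : bool) (G : game) : bool :=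
  let: Game GL GR := G in
  if left_to_move then has (left_wins false) GL else all (left_wins true) GR.

Definition game_ge (G H : game) : bool := left_wins false (game_sub G H).

Definition game_eqv (G H : game) : bool := game_ge G H && game_ge H G.

(* G is greater than or fuzzy with H: not G <= H. *)
Definition game_gf (G H : game) : bool := ~~ game_ge H G.

Definition dyadic (x : rat) : Prop :=
  exists (m : int) (k : nat), x = m%:~R / 2 ^+ k.

Definition nat_game (n : nat) : game :=
  iter n (fun G => Game [:: G] [::]) (Game [::] [::]).

Definition int_game (n : int) : game :=
  match n with
  | Posz k => nat_game k
  | Negz k => game_opp (nat_game k.+1)
  end.

(* Canonical form of m / 2 ^ k.  When m is odd and k > 0 it is
   { (m - 1) / 2 ^ k | (m + 1) / 2 ^ k }. *)
Fixpoint frac_game (k : nat) (m : int) : game :=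
  if k is k'.+1 then
    if (2 %| m)%Z then frac_game k' (m %/ 2)%Z
    else Game [:: frac_game k' ((m - 1) %/ 2)%Z]
              [:: frac_game k' ((m + 1) %/ 2)%Z]
  else int_game m.

(* Canonical form of a dyadic rational; a junk value when x is not dyadic. *)
Definition num_game (x : rat) : game :=
  frac_game (logn 2 `|denq x|%N) (numq x).

(* The maximum and minimum of a nonempty list; 0 for the empty list. *)
Definition seq_max (s : seq rat) : rat := \big[Order.max/head 0 s]_(x <- s) x.
Definition seq_min (s : seq rat) : rat := \big[Order.min/head 0 s]_(x <- s) x.

Definition is_integer_game (G : game) : Prop :=
  exists n : int, game_eqv G (int_game n).

(* [xget a A] is a chosen element of A, or a when A is empty; the integer equal
   to G is unique when it exists. *)
Definition integer_value (G : game) : int :=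
  xget 0 [set n : int | game_eqv G (int_game n)]%classic.

(* The minimum of the set of dyadic rationals satisfying P; 0 if there is none. *)
Definition dyadic_min (P : rat -> Prop) : rat :=
  xget 0 [set s | [/\ dyadic s, P s &
                   forall s', dyadic s' -> P s' -> s <= s']]%classic.

(* For a fixed G, the data t |-> lambda_t(G), t |-> rho_t(G), t |-> G_t and
   t(G), where None stands for a temperature of minus infinity.  As functions
   of t they are only meaningful at dyadic t. *)
Record cooling := Cooling {
  cooling_lambda : rat -> rat;
  cooling_rho : rat -> rat;
  cooling_game : rat -> game;
  cooling_temp : option rat
}.

Definition integer_cooling (n : int) : cooling :=
  Cooling (fun=> n%:~R) (fun=> n%:~R) (fun=> int_game n) None.

(* TL and TR are the data of the Left and of the Right options of a game that is
   not equal to an integer; such a game has both Left and Right options, so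
   seq_max and seq_min are never taken of an empty list. *)
Definition noninteger_cooling (TL TR : seq cooling) : cooling :=
  let lambda' t := seq_max [seq cooling_rho T t - t | T <- TL] in
  let rho' t := seq_min [seq cooling_lambda T t + t | T <- TR] in
  let game' t :=
    Game [seq game_sub (cooling_game T t) (num_game t) | T <- TL]
         [seq game_add (cooling_game T t) (num_game t) | T <- TR] in
  let temp := dyadic_min (fun t => lambda' t = rho' t) in
  let x := lambda' temp in
  Cooling (fun t => if t <= temp then lambda' t else x)
          (fun t => if t <= temp then rho' t else x)
          (fun t => if t <= temp then game' t else num_game x)
          (Some temp).

Fixpoint cooling_of (G : game) : cooling :=
  let: Game GL GR := G in
  if `[< is_integer_game G >] then integer_cooling (integer_value G)
  else noninteger_cooling (map cooling_of GL) (map cooling_of GR).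

Definition left_wall (t : rat) (G : game) : rat := cooling_lambda (cooling_of G) t.
Definition right_wall (t : rat) (G : game) : rat := cooling_rho (cooling_of G) t.
Definition cool (t : rat) (G : game) : game := cooling_game (cooling_of G) t.
Definition temperature (G : game) : option rat := cooling_temp (cooling_of G).

(* Main.v *)
Require Import Defs.
From mathcomp Require Import all_boot all_order all_algebra.
From mathcomp Require Import boolp classical_sets.
From mathcomp Require Import zify ring lra.
From HB Require Import structures.
Set Implicit Arguments.
Unset Strict Implicit.
Unset Printing Implicit Defensive.
Import Order.TTheory GRing.Theory Num.Theory.
Local Open Scope ring_scope.

(* Both claims go by simultaneous induction on the two game trees.  When t is
   at most both temperatures, the options of G_t and H_t are the cooled options
   and the induction is immediate.  When t exceeds both, one compares the walls
   at the larger of the two temperatures.  The delicate case is t between the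
   temperatures, G_t = y being frozen: if y were <= H_t - t with G^L >= H, then
   the right wall of G^L would have slope 1 just below t, and a wall that is
   slanted there pins down the sign of the infinitesimal part of G^L_t
   (wall_slope_sign), a contradiction.  The same slope argument, run from -1 up
   to t, settles games equal to an integer: at -1 the walls of any game are its
   best integer bounds, which is also why temperatures exceed -1. *)

(** * Games as a preordered group *)

(** The shift by [t] in the second claim is the price of one move: from $G^L \ge H$ the option
    $G^L_t - t$ of $G_t$ is only known to dominate $H_t - t$. Walls determine a cooled game up to an
    infinitesimal: they settle its comparison with every number strictly off both walls, and nothing
    about a number lying on a wall. The difficulty sits in these ties, and the slope argument serves
    to break them.

    A temperature is a minimum over an infinite set and [dyadic_min] falls back to 0 if there is
    none, so existence has to be proved. This is why walls are shown to be affine on the cells of a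
    dyadic grid: the gap between the two tilde walls is positive at -1 and at most 0 for large $t$,
    so it has a first zero, which is dyadic. Positivity at -1 is integrality: the best integer
    bounds from above and below coincide only for a game equal to an integer. *)

HB.instance Definition _ := gen_eqMixin game.

Definition lopts (G : game) := let: Game GL _ := G in GL.
Definition ropts (G : game) := let: Game _ GR := G in GR.

Fixpoint rank (G : game) : nat :=
  let: Game GL GR := G in
  (maxn (foldr maxn 0 (map rank GL)) (foldr maxn 0 (map rank GR))).+1.

Lemma leq_foldr_max (f : game -> nat) s X :
  X \in s -> (f X <= foldr maxn 0 (map f s))%N.
Proof.
elim: s => //= Y s IH; rewrite inE => /orP[/eqP-> | /IH]; first exact: leq_maxl.
by move/leq_trans; apply; exact: leq_maxr.
Qed.

Lemma rank_lopts G X : X \in lopts G -> (rank X < rank G)%N.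
Proof.
case: G => GL GR /= /(leq_foldr_max rank) h.
by rewrite ltnS (leq_trans h) ?leq_maxl.
Qed.

Lemma rank_ropts G X : X \in ropts G -> (rank X < rank G)%N.
Proof.
case: G => GL GR /= /(leq_foldr_max rank) h.
by rewrite ltnS (leq_trans h) ?leq_maxr.
Qed.

(** The principle generated for [game] gives no hypothesis on the games nested in the option lists,
    so the induction goes through [rank]. *)
Lemma game_rect_opts (P : game -> Prop) :
  (forall G, (forall X, X \in lopts G -> P X) ->
             (forall X, X \in ropts G -> P X) -> P G) ->
  forall G, P G.
Proof.
move=> IH G; have [n] := ubnP (rank G); elim: n G => // n IHn G lt_n.
by apply: IH => X X_opt; apply: IHn;
  [have := rank_lopts X_opt | have := rank_ropts X_opt]; lia.
Qed.

Lemma game_optsE G : G = Game (lopts G) (ropts G).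
Proof. by case: G. Qed.

Lemma lopts_add G H : lopts (game_add G H) =
  [seq game_add X H | X <- lopts G] ++ [seq game_add G Y | Y <- lopts H].
Proof. by case: G => ? ?; case: H. Qed.

Lemma ropts_add G H : ropts (game_add G H) =
  [seq game_add X H | X <- ropts G] ++ [seq game_add G Y | Y <- ropts H].
Proof. by case: G => ? ?; case: H. Qed.

Lemma lopts_opp G : lopts (game_opp G) = map game_opp (ropts G).
Proof. by case: G. Qed.

Lemma ropts_opp G : ropts (game_opp G) = map game_opp (lopts G).
Proof. by case: G. Qed.

Lemma game_oppK : involutive game_opp.
Proof.
elim/game_rect_opts => -[GL GR] /= IHL IHR.
by congr Game; rewrite -map_comp -[RHS]map_id; apply/eq_in_map => X /=;
  [move/IHL | move/IHR].
Qed.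

Lemma rank_opp G : rank (game_opp G) = rank G.
Proof.
elim/game_rect_opts: G => -[GL GR] /= IHL IHR.
rewrite maxnC -!map_comp (eq_in_map (rank \o game_opp) rank GL).1 //.
by rewrite (eq_in_map (rank \o game_opp) rank GR).1.
Qed.

Lemma game_oppD G H :
  game_opp (game_add G H) = game_add (game_opp G) (game_opp H).
Proof.
elim/game_rect_opts: G H => G GL GR; elim/game_rect_opts => H HL HR.
rewrite [LHS]game_optsE [RHS]game_optsE !(lopts_opp, ropts_opp, lopts_add, ropts_add) !map_cat.
rewrite -!map_comp.
congr (Game (_ ++ _) (_ ++ _)); apply/eq_in_map => X /= hX;
  first [by rewrite GL | by rewrite GR | by rewrite HL | by rewrite HR].
Qed.

Lemma game_addA : associative game_add.
Proof.
elim/game_rect_opts => A AL AR; elim/game_rect_opts => B BL BR.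
elim/game_rect_opts => C CL CR.
rewrite [LHS]game_optsE [RHS]game_optsE !(lopts_add, ropts_add) !map_cat -!catA.
rewrite -!map_comp.
congr (Game (_ ++ _ ++ _) (_ ++ _ ++ _)); apply/eq_in_map => X /= hX;
  first [by rewrite AL | by rewrite AR | by rewrite BL | by rewrite BR
        | by rewrite CL | by rewrite CR].
Qed.

Lemma left_wins_trueE G : left_wins true G = has (left_wins false) (lopts G).
Proof. by case: G. Qed.

Lemma left_wins_falseE G : left_wins false G = all (left_wins true) (ropts G).
Proof. by case: G. Qed.

Lemma left_wins_opp b G : left_wins b (game_opp G) = ~~ left_wins (~~ b) G.
Proof.
elim/game_rect_opts: G b => G GL GR [] /=.
  rewrite left_wins_trueE left_wins_falseE lopts_opp has_map -has_predC.
  by apply: eq_in_has => X /= hX; rewrite GR.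
rewrite left_wins_trueE left_wins_falseE ropts_opp all_map -all_predC.
by apply: eq_in_all => X /= hX; rewrite GL.
Qed.

(** Commuting a sum permutes the option lists, so unlike [game_addA] this is not an equality of
    trees; only the outcome is preserved. *)
Lemma left_wins_addC b G H :
  left_wins b (game_add G H) = left_wins b (game_add H G).
Proof.
elim/game_rect_opts: G H b => G GL GR; elim/game_rect_opts => H HL HR [].
  rewrite !left_wins_trueE !lopts_add !has_cat orbC !has_map.
  congr orb; apply: eq_in_has => X /= hX; first [by rewrite GL | by rewrite HL].
rewrite !left_wins_falseE !ropts_add !all_cat andbC !all_map.
congr andb; apply: eq_in_all => X /= hX; first [by rewrite GR | by rewrite HR].
Qed.

(** Conway's recursive description of the order: Right moves from $G - H$ to $G^R - H$ or $G - H^L$,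
    and negating that position turns a Left win moving first into the failure of the reverse
    comparison. *)
Lemma game_geE G H : game_ge G H =
  all (fun X => ~~ game_ge H X) (ropts G) &&
  all (fun Y => ~~ game_ge Y G) (lopts H).
Proof.
rewrite {1}/game_ge /game_sub left_wins_falseE ropts_add ropts_opp all_cat.
rewrite !all_map; congr andb; apply: eq_all => X /=.
  by rewrite -[game_add _ _]game_oppK left_wins_opp game_oppD game_oppK
     left_wins_addC.
by rewrite -[game_add _ _]game_oppK left_wins_opp game_oppD game_oppK
   left_wins_addC.
Qed.

Lemma game_geP G H : reflect
  ((forall X, X \in ropts G -> ~~ game_ge H X) /\
   (forall Y, Y \in lopts H -> ~~ game_ge Y G)) (game_ge G H).
Proof. by rewrite game_geE; apply: (iffP andP) => -[/allP ? /allP ?]. Qed.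

Lemma game_gfP G H : reflect
  ((exists2 X, X \in lopts G & game_ge X H) \/
   (exists2 Y, Y \in ropts H & game_ge G Y)) (game_gf G H).
Proof.
rewrite /game_gf game_geE negb_and -!has_predC.
apply: (iffP orP) => -[].
- by case/hasP=> X hX /negbNE h; right; exists X.
- by case/hasP=> X hX /negbNE h; left; exists X.
- by case=> X hX h; right; apply/hasP; exists X => //=; rewrite h.
- by case=> X hX h; left; apply/hasP; exists X => //=; rewrite h.
Qed.

Lemma game_ge_refl G : game_ge G G.
Proof.
elim/game_rect_opts: G => G GL GR; apply/game_geP; split=> X hX; apply/negP.
  by case/game_geP => /(_ _ hX) /negP h _; apply: h; exact: GR.
by case/game_geP => _ /(_ _ hX) /negP; apply; exact: GL.
Qed.

Lemma lopts_gf G X : X \in lopts G -> game_gf G X.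
Proof. by move=> hX; apply/game_gfP; left; exists X => //; exact: game_ge_refl. Qed.

Lemma ropts_gf G X : X \in ropts G -> game_gf X G.
Proof. by move=> hX; apply/game_gfP; right; exists X => //; exact: game_ge_refl. Qed.

Lemma game_ge_trans B A C : game_ge A B -> game_ge B C -> game_ge A C.
Proof.
have [n] := ubnP (rank A + rank B + rank C)%N.
elim: n A B C => // n IH A B C lt_n AB BC.
case/game_geP: (AB) => AB1 AB2; case/game_geP: (BC) => BC1 BC2.
apply/game_geP; split=> X hX; apply/negP => h.
  apply/negP: (AB1 _ hX); rewrite negbK; apply: IH BC h.
  by have := rank_ropts hX; lia.
apply/negP: (BC2 _ hX); rewrite negbK; apply: IH h AB.
by have := rank_lopts hX; lia.
Qed.

Lemma game_gf_ge_trans B A C : game_gf A B -> game_ge B C -> game_gf A C.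
Proof. by move=> AB BC; apply: contra AB; apply: game_ge_trans. Qed.

Lemma game_ge_gf_trans B A C : game_ge A B -> game_gf B C -> game_gf A C.
Proof. by move=> AB BC; apply: contra BC => CA; apply: game_ge_trans AB. Qed.

Lemma game_ge_opp G H : game_ge (game_opp G) (game_opp H) = game_ge H G.
Proof. by rewrite /game_ge /game_sub game_oppK left_wins_addC. Qed.

Lemma game_gf_opp G H : game_gf (game_opp G) (game_opp H) = game_gf H G.
Proof. by rewrite /game_gf game_ge_opp. Qed.

Lemma game_gf_ropts G H X : game_ge G H -> X \in ropts G -> game_gf X H.
Proof. by case/game_geP => + _ hX; apply. Qed.

Lemma game_gf_lopts G H X : game_ge G H -> X \in lopts H -> game_gf G X.
Proof. by case/game_geP => _ + hX; apply. Qed.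

(** The two directions feed each other: cancelling [C] uses translation for the options of [A] and
    [B], and translating uses cancellation there. A move in [C] is matched by the same move in the
    other sum. *)
Lemma game_ge_add2r C A B :
  game_ge (game_add A C) (game_add B C) = game_ge A B.
Proof.
have [n] := ubnP (rank A + rank B + rank C)%N.
elim: n A B C => // n IH A B C lt_n.
apply/idP/idP => h; apply/game_geP; split=> X hX; apply/negP.
- rewrite -(IH _ _ C) => [BX|]; last by have := rank_ropts hX; lia.
  apply/negP: (game_ge_trans h BX); apply: ropts_gf.
  by rewrite ropts_add mem_cat (map_f (game_add^~ C)).
- rewrite -(IH _ _ C) => [BX|]; last by have := rank_lopts hX; lia.
  apply/negP: (game_ge_trans BX h); apply: lopts_gf.
  by rewrite lopts_add mem_cat (map_f (game_add^~ C)).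
- move: hX; rewrite ropts_add mem_cat => /orP[/mapP|/mapP] [Y hY ->].
    rewrite IH; last by have := rank_ropts hY; lia.
    by apply/negP; apply: game_gf_ropts hY.
  move=> ge; have: game_ge (game_add B C) (game_add B Y).
    by apply: game_ge_trans ge _; rewrite IH //; have := rank_ropts hY; lia.
  by apply/negP/ropts_gf; rewrite ropts_add mem_cat (map_f (game_add B)) ?orbT.
- move: hX; rewrite lopts_add mem_cat => /orP[/mapP|/mapP] [Y hY ->].
    rewrite IH; last by have := rank_lopts hY; lia.
    by apply/negP; apply: game_gf_lopts hY.
  move=> ge; have: game_ge (game_add A Y) (game_add A C).
    by apply: game_ge_trans ge; rewrite IH //; have := rank_lopts hY; lia.
  by apply/negP/lopts_gf; rewrite lopts_add mem_cat (map_f (game_add A)) ?orbT.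
Qed.

Lemma game_ge_addC A B : game_ge (game_add A B) (game_add B A).
Proof.
elim/game_rect_opts: A B => A AL AR; elim/game_rect_opts => B BL BR.
apply/game_geP; split=> X.
  rewrite ropts_add mem_cat => /orP[]/mapP[Y hY ->]; apply/negP.
    move/game_ge_trans => /(_ _ (AR _ hY B)); apply/negP/ropts_gf.
    by rewrite ropts_add mem_cat (map_f (game_add B)) ?orbT.
  move/game_ge_trans => /(_ _ (BR _ hY)); apply/negP/ropts_gf.
  by rewrite ropts_add mem_cat (map_f (game_add^~ A)).
rewrite lopts_add mem_cat => /orP[]/mapP[Y hY ->]; apply/negP.
  move/(game_ge_trans (BL _ hY)); apply/negP/lopts_gf.
  by rewrite lopts_add mem_cat (map_f (game_add A)) ?orbT.
move/(game_ge_trans (AL _ hY B)); apply/negP/lopts_gf.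
by rewrite lopts_add mem_cat (map_f (game_add^~ B)).
Qed.

Lemma game_ge_addCr A B C :
  game_ge A (game_add B C) = game_ge A (game_add C B).
Proof.
by apply/idP/idP => h; apply: game_ge_trans h _; exact: game_ge_addC.
Qed.

Lemma game_ge_addCl A B C :
  game_ge (game_add B C) A = game_ge (game_add C B) A.
Proof. by apply/idP/idP => h; apply: game_ge_trans (game_ge_addC _ _) h. Qed.

Lemma game_ge_add2l C A B :
  game_ge (game_add C A) (game_add C B) = game_ge A B.
Proof. by rewrite game_ge_addCr game_ge_addCl game_ge_add2r. Qed.

Lemma game_ge_subl A B C :
  game_ge (game_sub A C) B = game_ge A (game_add B C).
Proof.
by rewrite game_ge_addCr /game_ge /game_sub game_oppD game_addA.
Qed.

Lemma game_ge_subr A B C :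
  game_ge A (game_sub B C) = game_ge (game_add A C) B.
Proof.
by rewrite -game_ge_opp game_oppD -/(game_sub _ _) game_ge_subl -game_oppD
  game_ge_opp.
Qed.

(** * Dyadic numbers as games *)

Lemma dyadic_int (n : int) : dyadic n%:~R.
Proof. by exists n, 0; rewrite expr0 divr1. Qed.

Lemma dyadic_half x : dyadic x -> dyadic (x / 2).
Proof. by case=> m [k ->]; exists m, k.+1; rewrite exprSr invfM mulrA. Qed.

Lemma expr2n_neq0 k : (2 : rat) ^+ k != 0.
Proof. by rewrite expf_neq0. Qed.

Lemma dyadicP x : dyadic x <-> exists k, x * 2 ^+ k \is a Num.int.
Proof.
split=> [[m [k ->]]|[k /intrP[m h]]].
  by exists k; rewrite mulfVK ?expr2n_neq0.
by exists m, k; rewrite -h mulfK ?expr2n_neq0.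
Qed.

Lemma dyadicD x y : dyadic x -> dyadic y -> dyadic (x + y).
Proof.
move=> /dyadicP[k hx] /dyadicP[l hy]; apply/dyadicP; exists (k + l)%N.
rewrite exprD mulrDl mulrA [2 ^+ k * _]mulrC [y * _]mulrA.
by rewrite rpredD // rpredM ?rpredX.
Qed.

Lemma dyadicN x : dyadic x -> dyadic (- x).
Proof. by move=> /dyadicP[k hx]; apply/dyadicP; exists k; rewrite mulNr rpredN. Qed.

Lemma dyadicB x y : dyadic x -> dyadic y -> dyadic (x - y).
Proof. by move=> hx hy; apply/dyadicD/dyadicN. Qed.

Lemma num_game_int (n : int) : num_game n%:~R = int_game n.
Proof. by rewrite /num_game denq_int numq_int. Qed.

Lemma numq_denq_odd_frac k (m : int) : ~~ (2 %| m)%Z ->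
  numq (m%:~R / 2 ^+ k) = m /\ denq (m%:~R / 2 ^+ k) = 2 ^+ k.
Proof.
move=> m_odd; have -> : (2 : rat) ^+ k = ((2 : int) ^+ k)%:~R by rewrite rmorphXn.
have cop : coprime `|m| `|(2 : int) ^+ k|.
  by rewrite abszX coprimeXr // coprime_sym prime_coprime.
by rewrite coprimeq_num // coprimeq_den // expf_eq0 andbF gtr0_sg ?exprn_gt0 // mul1r
  gtr0_norm ?exprn_gt0.
Qed.

Lemma half_frac k (m : int) : (2 %| m)%Z ->
  m%:~R / 2 ^+ k.+1 = (m %/ 2)%Z%:~R / 2 ^+ k :> rat.
Proof.
move=> m_even; rewrite exprS invfM mulrA; congr (_ * _).
by rewrite -{1}(divzK m_even) rmorphM mulfK.
Qed.

Lemma frac_gameE k (m : int) : frac_game k m = num_game (m%:~R / 2 ^+ k).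
Proof.
elim: k m => [|k IH] m; first by rewrite expr0 divr1 num_game_int.
have [m_even|m_odd] := boolP (2 %| m)%Z.
  by rewrite /= m_even IH half_frac.
have [h1 h2] := numq_denq_odd_frac k.+1 m_odd.
by rewrite /num_game h1 h2 abszX lognX logn_prime //= muln1.
Qed.

(** One formula covers all canonical forms: the options are the neighbours on the grid whose mesh is
    the inverse of the denominator. An integer thus has step 1, and lacks the option lying farther
    from 0 (both options if it is 0). *)
Definition num_step (x : rat) : rat := (denq x)%:~R^-1.
Definition num_lopts (x : rat) : seq rat :=
  if (denq x == 1) && (x <= 0) then [::] else [:: x - num_step x].
Definition num_ropts (x : rat) : seq rat :=
  if (denq x == 1) && (0 <= x) then [::] else [:: x + num_step x].

Lemma num_gameE x : dyadic x ->
  num_game x = Game (map num_game (num_lopts x)) (map num_game (num_ropts x)).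
Proof.
case=> m [k ->]; elim: k m => [|k IH] m.
  rewrite expr0 divr1 num_game_int /num_lopts /num_ropts /num_step denq_int eqxx /=.
  rewrite ler0z lerz0 invr1.
  have -> : m%:~R - 1 = (m - 1)%:~R :> rat by rewrite rmorphB.
  have -> : m%:~R + 1 = (m + 1)%:~R :> rat by rewrite rmorphD.
  case: m => [[|n]|n] //=.
    rewrite num_game_int; have -> // : (n.+1%:Z - 1) = n by lia.
  rewrite num_game_int; congr Game; congr [:: _].
  case: n => [|n] //=.
  by rewrite subn1.
have [m_even|m_odd] := boolP (2 %| m)%Z; first by rewrite half_frac.
have [h1 h2] := numq_denq_odd_frac k.+1 m_odd.
rewrite -frac_gameE /= (negPf m_odd) /num_lopts /num_ropts /num_step h2.
have -> /= : (2 ^+ k.+1 == 1 :> int) = false by rewrite exprS; lia.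
rewrite !frac_gameE -!half_frac; [|lia|lia].
by rewrite !rmorphXn intrB intrD mulrBl mulrDl mul1r.
Qed.

Lemma num_step_gt0 x : 0 < num_step x.
Proof. by rewrite invr_gt0 ltr0z denq_gt0. Qed.

Lemma dyadic_num_step x : dyadic x -> dyadic (num_step x).
Proof.
case=> m [k ->]; elim: k m => [|k IH] m.
  by rewrite expr0 divr1 /num_step denq_int invr1; exact: (dyadic_int 1).
have [m_even|m_odd] := boolP (2 %| m)%Z; first by rewrite half_frac.
have [h1 h2] := numq_denq_odd_frac k.+1 m_odd.
by exists 1, k.+1; rewrite /num_step h2 rmorphXn mul1r.
Qed.

Lemma num_loptsP x y : y \in num_lopts x -> y = x - num_step x.
Proof. by rewrite /num_lopts; case: ifP; rewrite // inE => _ /eqP. Qed.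

Lemma num_roptsP x y : y \in num_ropts x -> y = x + num_step x.
Proof. by rewrite /num_ropts; case: ifP; rewrite // inE => _ /eqP. Qed.

Lemma lopts_num x X : dyadic x -> X \in lopts (num_game x) ->
  exists y, [/\ X = num_game y, y \in num_lopts x, dyadic y & y < x].
Proof.
move=> hx; rewrite num_gameE //= => /mapP[y hy ->]; exists y.
have step := num_step_gt0 x; have dstep := dyadic_num_step hx.
by split=> //; rewrite (num_loptsP hy); [exact: dyadicB | lra].
Qed.

Lemma ropts_num x X : dyadic x -> X \in ropts (num_game x) ->
  exists y, [/\ X = num_game y, y \in num_ropts x, dyadic y & x < y].
Proof.
move=> hx; rewrite num_gameE //= => /mapP[y hy ->]; exists y.
have step := num_step_gt0 x; have dstep := dyadic_num_step hx.
by split=> //; rewrite (num_roptsP hy); [exact: dyadicD | lra].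
Qed.

Lemma game_opp_num x : dyadic x -> game_opp (num_game x) = num_game (- x).
Proof.
move=> hx; have [n] := ubnP (rank (num_game x)); elim: n x hx => // n IH x hx lt_n.
rewrite (num_gameE (dyadicN hx)) [LHS]game_optsE lopts_opp ropts_opp {1 2}num_gameE //=.
rewrite -!map_comp /num_lopts /num_ropts /num_step denqN oppr_ge0 oppr_le0.
have hl := @rank_lopts (num_game x); have hr := @rank_ropts (num_game x).
move: hl hr; rewrite {1 3}num_gameE //= => hl hr.
have dstep := dyadic_num_step hx.
congr Game.
  rewrite /num_ropts in hr; case: ifP hr => //= _ hr; rewrite IH.
  - by rewrite opprD.
  - exact: dyadicD.
  - by have := hr _ (mem_head _ _); lia.
rewrite /num_lopts in hl; case: ifP hl => //= _ hl; rewrite IH.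
- by rewrite opprB addrC.
- exact: dyadicB.
- by have := hl _ (mem_head _ _); lia.
Qed.

Lemma intr_expr2n k : (2 : rat) ^+ k \is a Num.int.
Proof. by rewrite rpredX. Qed.

Lemma expr2n_gt0 k : 0 < (2 : rat) ^+ k.
Proof. by rewrite exprn_gt0. Qed.

Lemma int_expr2nW k l (x : rat) :
  (k <= l)%N -> x * 2 ^+ k \is a Num.int -> x * 2 ^+ l \is a Num.int.
Proof. by move=> /subnKC <- hx; rewrite exprD mulrA rpredM ?intr_expr2n. Qed.

Lemma grid_lt l (x y : rat) : x * 2 ^+ l \is a Num.int -> y * 2 ^+ l \is a Num.int ->
  x < y -> x + (2 ^+ l)^-1 <= y.
Proof.
move=> hx hy; rewrite -(ltr_pM2r (expr2n_gt0 l)) => lt_xy.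
rewrite -(ler_pM2r (expr2n_gt0 l)) mulrDl mulVf ?expr2n_neq0 //.
move: lt_xy; case/intrP: hx => m ->; case/intrP: hy => n ->.
by rewrite ltr_int -(intrD _ _ 1) ler_int; lia.
Qed.

(* [k] is the exponent of 2 in the denominator of [x]. *)
Lemma num_stepP x : dyadic x -> exists k,
  [/\ num_step x = (2 ^+ k)^-1, x * 2 ^+ k \is a Num.int,
      forall l, x * 2 ^+ l \is a Num.int -> (k <= l)%N,
      ((0 < k)%N \/ 0 < x -> num_lopts x = [:: x - num_step x]) &
      ((0 < k)%N \/ x < 0 -> num_ropts x = [:: x + num_step x])].
Proof.
case=> m [k ->]; elim: k m => [|k IH] m.
  exists 0; rewrite expr0 divr1 /num_lopts /num_ropts /num_step denq_int eqxx /=.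
  split=> //; first (by rewrite mulr1);
    by case=> // h; rewrite leNgt h.
have [m_even|m_odd] := boolP (2 %| m)%Z; first by rewrite half_frac.
have [h1 h2] := numq_denq_odd_frac k.+1 m_odd.
have d1 : (denq (m%:~R / 2 ^+ k.+1) == 1) = false by rewrite h2 exprS; lia.
exists k.+1; rewrite /num_lopts /num_ropts d1 /num_step h2; split=> //.
- by rewrite rmorphXn.
- by rewrite mulfVK ?expr2n_neq0.
move=> l; rewrite leqNgt; apply: contraL => lt_lk.
have -> : m%:~R / 2 ^+ k.+1 * 2 ^+ l = m%:~R / 2 ^+ (k.+1 - l) :> rat.
  by rewrite -(subnK (ltnW lt_lk)) addnK exprD; field; rewrite ?expr2n_neq0.
have [_ h3] := numq_denq_odd_frac (k.+1 - l) m_odd.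
rewrite Qint_def h3 -(prednK (_ : 0 < k.+1 - l)%N) ?subn_gt0 //.
by rewrite exprS; lia.
Qed.

(** Both numbers lie on the grid of the larger denominator, so the option of its owner does not
    overshoot the other number. For two integers the sign decides: [y] has a Left option only if
    [0 < y], and [x] a Right option only if [x < 0]. *)
Lemma num_opts_between x y : dyadic x -> dyadic y -> x < y ->
  (exists2 z, z \in num_ropts x & z <= y) \/
  (exists2 z, z \in num_lopts y & x <= z).
Proof.
move=> /num_stepP[k [sk xk _ _ rk]] /num_stepP[l [sl yl _ ll _]] lt_xy.
have left : (k <= l)%N -> (0 < l)%N \/ 0 < y ->
    exists2 z, z \in num_lopts y & x <= z.
  move=> le_kl /ll ->; exists (y - num_step y); rewrite ?mem_head // sl.
  by have := grid_lt (int_expr2nW le_kl xk) yl lt_xy; lra.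
have right : (l <= k)%N -> (0 < k)%N \/ x < 0 ->
    exists2 z, z \in num_ropts x & z <= y.
  move=> le_lk /rk ->; exists (x + num_step x); rewrite ?mem_head // sk.
  exact: grid_lt xk (int_expr2nW le_lk yl) lt_xy.
case: (ltngtP k l) => [lt_kl|lt_lk|eq_kl].
- by right; apply: left; lia.
- by left; apply: right; lia.
case: (posnP l) => [l0|l0]; last by right; apply: left; lia.
have [y0|y0] := ltP 0 y; first by right; apply: left; [lia | right].
by left; apply: right; [lia | right; lra].
Qed.

Lemma game_ge_num x y : dyadic x -> dyadic y ->
  game_ge (num_game x) (num_game y) = (y <= x).
Proof.
have [n] := ubnP (rank (num_game x) + rank (num_game y))%N.
elim: n x y => // n IH x y lt_n hx hy.
have ropt X : X \in ropts (num_game x) -> exists z,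
    [/\ X = num_game z, dyadic z, x < z & game_ge (num_game y) X = (z <= y)].
  move=> hX; have [z [eX _ dz lt_z]] := ropts_num hx hX.
  exists z; rewrite eX IH //; have := rank_ropts hX; rewrite eX; lia.
have lopt X : X \in lopts (num_game y) -> exists z,
    [/\ X = num_game z, dyadic z, z < y & game_ge X (num_game x) = (x <= z)].
  move=> hX; have [z [eX _ dz lt_z]] := lopts_num hy hX.
  exists z; rewrite eX IH //; have := rank_lopts hX; rewrite eX; lia.
apply/idP/idP => [/game_geP[hr hl]|le_yx].
  rewrite leNgt; apply/negP => /(num_opts_between hx hy) [] [z hz le_z].
    have hX : num_game z \in ropts (num_game x) by rewrite (num_gameE hx) map_f.
    have [w [_ dw lt_w eq_w]] := ropt _ hX.
    have := hr _ hX; rewrite IH ?le_z //.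
      by have := rank_ropts hX; lia.
    by rewrite (num_roptsP hz); apply/dyadicD/dyadic_num_step.
  have hX : num_game z \in lopts (num_game y) by rewrite (num_gameE hy) map_f.
  have := hl _ hX; rewrite IH ?le_z //.
    by have := rank_lopts hX; lia.
  by rewrite (num_loptsP hz); apply/dyadicB/dyadic_num_step.
apply/game_geP; split=> X /[dup] hX; [move/ropt | move/lopt];
  by case=> z [_ _ lt_z ->]; rewrite -ltNge; lra.
Qed.

(** The Left move is made in the summand with the larger denominator (for integers, in a positive
    one). It costs that summand's step, which is at most the step of [x + y], whose denominator is
    no larger. For two nonpositive integers [x + y] has no Left option. *)
Lemma num_lopts_add x y z : dyadic x -> dyadic y -> z \in num_lopts (x + y) ->
  (exists2 w, w \in num_lopts x & z <= w + y) \/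
  (exists2 w, w \in num_lopts y & z <= x + w).
Proof.
move=> hx hy; have hxy := dyadicD hx hy.
have [k [sk xk kmin lk _]] := num_stepP hx.
have [l [sl yl lmin ll _]] := num_stepP hy.
have [m [sm _ mmin _ _]] := num_stepP hxy.
move=> hz; have zE := num_loptsP hz.
have step_le i : (m <= i)%N -> (2 ^+ i)^-1 <= num_step (x + y).
  by move=> le_mi; rewrite sm lef_pV2 ?posrE ?expr2n_gt0 // ler_weXn2l.
have left : (l <= k)%N -> (0 < k)%N \/ 0 < x ->
    exists2 w, w \in num_lopts x & z <= w + y.
  move=> le_lk /lk ->; exists (x - num_step x); rewrite ?mem_head // sk zE.
  have /step_le : (m <= k)%N by apply: mmin; rewrite mulrDl rpredD // (int_expr2nW le_lk).
  lra.
have right : (k <= l)%N -> (0 < l)%N \/ 0 < y ->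
    exists2 w, w \in num_lopts y & z <= x + w.
  move=> le_kl /ll ->; exists (y - num_step y); rewrite ?mem_head // sl zE.
  have /step_le : (m <= l)%N by apply: mmin; rewrite mulrDl rpredD // (int_expr2nW le_kl).
  lra.
case: (ltngtP k l) => [lt_kl|lt_lk|eq_kl].
- by right; apply: right; lia.
- by left; apply: left; lia.
case: (posnP l) => [l0|l0]; last by right; apply: right; lia.
have [y0|y0] := ltP 0 y; first by right; apply: right; [lia | right].
have [x0|x0] := ltP 0 x; first by left; apply: left; [lia | right].
move: hz xk yl; rewrite eq_kl l0 expr0 !mulr1 /num_lopts -Qint_def => + xi yi.
by rewrite rpredD //= (_ : x + y <= 0) //; lra.
Qed.

Lemma num_game_addge x y : dyadic x -> dyadic y ->
  game_ge (game_add (num_game x) (num_game y)) (num_game (x + y)).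
Proof.
have [n] := ubnP (rank (num_game x) + rank (num_game y))%N.
elim: n x y => // n IH x y lt_n hx hy; have hxy := dyadicD hx hy.
apply/game_geP; split=> X.
  rewrite ropts_add mem_cat => /orP[]/mapP[Y hY ->]; apply/negP => ge;
    have lt_r := rank_ropts hY.
    have [z [eY _ dz lt_z]] := ropts_num hx hY.
    have /(game_ge_trans ge) : game_ge (game_add Y (num_game y)) (num_game (z + y)).
      by rewrite eY; apply: IH; rewrite -?eY //; lia.
    by rewrite game_ge_num //; [lra | exact: dyadicD].
  have [z [eY _ dz lt_z]] := ropts_num hy hY.
  have /(game_ge_trans ge) : game_ge (game_add (num_game x) Y) (num_game (x + z)).
    by rewrite eY; apply: IH; rewrite -?eY //; lia.
  by rewrite game_ge_num //; [lra | exact: dyadicD].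
move=> /(lopts_num hxy)[z [-> hz dz lt_z]]; apply/negP => ge.
case: (num_lopts_add hx hy hz) => [] [w hw le_z].
  have dw : dyadic w by rewrite (num_loptsP hw); apply/dyadicB/dyadic_num_step.
  have hW : num_game w \in lopts (num_game x) by rewrite (num_gameE hx) map_f.
  suff : game_ge (game_add (num_game w) (num_game y)) (game_add (num_game x) (num_game y)).
    by rewrite game_ge_add2r; apply/negP/lopts_gf.
  apply: game_ge_trans ge; apply: (game_ge_trans (IH w y _ dw hy)).
    by have := rank_lopts hW; lia.
  by rewrite game_ge_num //; exact: dyadicD.
have dw : dyadic w by rewrite (num_loptsP hw); apply/dyadicB/dyadic_num_step.
have hW : num_game w \in lopts (num_game y) by rewrite (num_gameE hy) map_f.
suff : game_ge (game_add (num_game x) (num_game w)) (game_add (num_game x) (num_game y)).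
  by rewrite game_ge_add2l; apply/negP/lopts_gf.
apply: game_ge_trans ge; apply: (game_ge_trans (IH x w _ hx dw)).
  by have := rank_lopts hW; lia.
by rewrite game_ge_num //; exact: dyadicD.
Qed.

Lemma num_game_addle x y : dyadic x -> dyadic y ->
  game_ge (num_game (x + y)) (game_add (num_game x) (num_game y)).
Proof.
move=> hx hy; rewrite -game_ge_opp game_oppD !game_opp_num ?opprD //; last exact: dyadicD.
by apply: num_game_addge; exact: dyadicN.
Qed.

Lemma game_ge_num_addr A x y : dyadic x -> dyadic y ->
  game_ge A (game_add (num_game x) (num_game y)) = game_ge A (num_game (x + y)).
Proof.
move=> hx hy; apply/idP/idP => /game_ge_trans; apply;
  [exact: num_game_addge | exact: num_game_addle].
Qed.

Lemma game_ge_num_addl A x y : dyadic x -> dyadic y ->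
  game_ge (game_add (num_game x) (num_game y)) A = game_ge (num_game (x + y)) A.
Proof.
move=> hx hy; apply/idP/idP; apply: game_ge_trans;
  [exact: num_game_addle | exact: num_game_addge].
Qed.

Lemma game_add_numE A t : dyadic t ->
  game_add A (num_game t) = game_sub A (num_game (- t)).
Proof. by move=> ht; rewrite /game_sub game_opp_num ?opprK //; exact: dyadicN. Qed.

Lemma sub_num_ge A x t : dyadic x -> dyadic t ->
  game_ge (game_sub A (num_game t)) (num_game x) = game_ge A (num_game (x + t)).
Proof. by move=> hx ht; rewrite game_ge_subl game_ge_num_addr. Qed.

Lemma num_ge_sub A x t : dyadic x -> dyadic t ->
  game_ge (num_game x) (game_sub A (num_game t)) = game_ge (num_game (x + t)) A.
Proof. by move=> hx ht; rewrite game_ge_subr game_ge_num_addl. Qed.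

Lemma num_ge_add A x t : dyadic x -> dyadic t ->
  game_ge (num_game x) (game_add A (num_game t)) = game_ge (num_game (x - t)) A.
Proof. by move=> hx ht; rewrite game_add_numE // num_ge_sub //; exact: dyadicN. Qed.

Lemma game_ge_int m n : game_ge (int_game m) (int_game n) = (n <= m).
Proof. by rewrite -!num_game_int game_ge_num ?ler_int //; exact: dyadic_int. Qed.

Lemma game_opp_int n : game_opp (int_game n) = int_game (- n).
Proof. by rewrite -!num_game_int game_opp_num ?rmorphN //; exact: dyadic_int. Qed.

Lemma lopts_int m X : X \in lopts (int_game m) -> 0 < m /\ X = int_game (m - 1).
Proof.
case: m => [[|n]|n] //=; rewrite inE => /eqP ->; split=> //.
by congr nat_game; rewrite subn1.
Qed.

Lemma ropts_int m X : X \in ropts (int_game m) -> m < 0 /\ X = int_game (m + 1).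
Proof.
rewrite -{1}[m]opprK -game_opp_int ropts_opp => /mapP[Y /lopts_int[m_gt ->] ->].
by rewrite game_opp_int opprB opprK addrC; split=> //; lia.
Qed.

(** * Simplicity and integer avoidance *)

(** Simplicity theorem for integers: if [m] fits between the options but is not equal to [G], the
    failing comparison shows that the option of [m], one step nearer to 0, fits as well. *)
Lemma simplest_integer m G :
  (forall X, X \in lopts G -> game_gf (int_game m) X) ->
  (forall X, X \in ropts G -> game_gf X (int_game m)) -> is_integer_game G.
Proof.
have [k] := ubnP `|m|%N; elim: k m => // k IH m lt_k hl hr.
have [ge|/game_gfP[[X hX ge]|[Y hY ge]]] := boolP (game_ge G (int_game m)); last first.
- by have := hr _ hY; rewrite /game_gf ge.
- have [m_gt eX] := lopts_int hX; move: ge; rewrite eX => ge.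
  apply: (IH (m - 1)) => [|Y hY|Y hY]; first lia.
    exact: game_ge_gf_trans ge (lopts_gf hY).
  by apply: game_gf_ge_trans (hr _ hY) _; rewrite game_ge_int; lia.
have [le|/game_gfP[[X hX le]|[Y hY le]]] := boolP (game_ge (int_game m) G); last first.
- have [m_gt eY] := ropts_int hY; move: le; rewrite eY => le.
  apply: (IH (m + 1)) => [|X hX|X hX]; first lia.
    by apply: game_ge_gf_trans (hl _ hX); rewrite game_ge_int; lia.
  exact: game_gf_ge_trans (ropts_gf hX) le.
- by have := hl _ hX; rewrite /game_gf le.
by exists m; rewrite /game_eqv ge le.
Qed.

Lemma is_integer_gameN G : is_integer_game (game_opp G) <-> is_integer_game G.
Proof.
suff opp H : is_integer_game H -> is_integer_game (game_opp H).
  by split=> /opp; rewrite ?game_oppK.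
by case=> n /andP[h1 h2]; exists (- n); rewrite -game_opp_int /game_eqv !game_ge_opp h1 h2.
Qed.

(** If the inequality failed, the Left option [n - 1] of [n] would be at least [G], hence would fit
    between the options of [G], and simplicity would make [G] an integer. Moves in the integer can
    therefore be ignored. *)
Lemma integer_avoidance_ge n G : ~ is_integer_game G ->
  (forall X, X \in ropts G -> game_gf X (int_game n)) -> game_ge G (int_game n).
Proof.
move=> nint hr; apply/negPn/negP => /game_gfP[[X hX ge]|[Y hY ge]]; last first.
  by have := hr _ hY; rewrite /game_gf ge.
have [m_gt eX] := lopts_int hX; move: ge; rewrite eX => ge.
apply: nint; apply: (@simplest_integer (n - 1)) => Y hY.
  exact: game_ge_gf_trans ge (lopts_gf hY).
by apply: game_gf_ge_trans (hr _ hY) _; rewrite game_ge_int; lia.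
Qed.

Lemma integer_avoidance_le n G : ~ is_integer_game G ->
  (forall X, X \in lopts G -> game_gf (int_game n) X) -> game_ge (int_game n) G.
Proof.
move=> nint hl; rewrite -game_ge_opp game_opp_int.
apply: integer_avoidance_ge; first by rewrite is_integer_gameN.
by move=> X; rewrite ropts_opp => /mapP[Y hY ->]; rewrite -game_opp_int game_gf_opp hl.
Qed.

(** * Wall functions *)

Definition antitone1 (f : rat -> rat) :=
  forall s t : rat, s <= t -> f t <= f s <= f t + (t - s).

(* Left walls, and opposites of right walls, are affine with slope 0 or -1 on
   the cells of a dyadic grid.  As slopes differ by at most 1 and values at grid
   points are on the grid, two such functions can only cross at grid points. *)
Definition piecewise (N : nat) (f : rat -> rat) :=
  forall k : int, exists (e : bool) (b : int), forall s : rat,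
    k%:~R <= s * 2 ^+ N <= (k + 1)%:~R ->
    f s = b%:~R / 2 ^+ N - (if e then s else 0).

Definition wall_like (f : rat -> rat) := antitone1 f /\ exists N, piecewise N f.

Lemma piecewiseS N f : piecewise N f -> piecewise N.+1 f.
Proof.
move=> pw k; have [e [b fE]] := pw (k %/ 2)%Z; exists e, (b * 2) => s /andP[h1 h2].
have E : (b * 2)%:~R / 2 ^+ N.+1 = b%:~R / 2 ^+ N :> rat.
  by rewrite intrM exprS; field; rewrite expr2n_neq0.
rewrite E; apply: fE.
have k1 : (2 * (k %/ 2)%Z)%:~R <= (k%:~R : rat) by rewrite ler_int; lia.
have k2 : (k + 1)%:~R <= ((2 * ((k %/ 2)%Z + 1))%:~R : rat) by rewrite ler_int; lia.
move: h1 h2 k1 k2; rewrite exprS [s * _]mulrCA !intrM; lra.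
Qed.

Lemma piecewiseW M N f : (M <= N)%N -> piecewise M f -> piecewise N f.
Proof.
move/subnKC <-; elim: (N - M)%N => [|n IH]; first by rewrite addn0.
by rewrite addnS => /IH/piecewiseS.
Qed.

Lemma wall_like_cst (n : int) : wall_like (fun=> n%:~R).
Proof.
split=> [s t|]; first lra.
by exists 0 => k; exists false, n => s _; rewrite expr0 divr1 subr0.
Qed.

(** This carries the wall of an option to its taxed contribution to the opposite wall: for a Right
    option, $-\lambda_t - t$ is the opposite of $\lambda_t + t$. The slopes 0 and -1 are
    exchanged. *)
Lemma wall_like_flip f : wall_like f -> wall_like (fun t => - f t - t).
Proof.
case=> anti [N pw]; split=> [s t /anti|]; first lra.
exists N => k; have [e [b fE]] := pw k; exists (~~ e), (- b) => s /fE ->.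
by case: e {fE}; rewrite /= intrN; lra.
Qed.

Lemma wall_like_max f g :
  wall_like f -> wall_like g -> wall_like (fun t => Order.max (f t) (g t)).
Proof.
move=> [fa [M fp]] [ga [N gp]]; split=> [s t le_st|].
  by have := fa _ _ le_st; have := ga _ _ le_st;
    case: (leP (f s) (g s)); case: (leP (f t) (g t)); lra.
have {}fp := piecewiseW (leq_maxl M N) fp; have {}gp := piecewiseW (leq_maxr M N) gp.
exists (maxn M N) => k; move: (maxn M N) fp gp => {}N fp gp.
have [e [b fE]] := fp k; have [d [c gE]] := gp k.
have pos : 0 < (2 ^+ N : rat)^-1 by rewrite invr_gt0 expr2n_gt0.
(* When the slopes differ, the two lines meet at [m / 2 ^+ N] for an integer [m], so comparing [m]
   with [k] tells which function is larger on the whole cell. *)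
have cross (m : int) (s : rat) : k%:~R <= s * 2 ^+ N <= (k + 1)%:~R ->
    if m <= k then m%:~R / 2 ^+ N <= s else s <= m%:~R / 2 ^+ N.
  case/andP=> h1 h2; case: ifP => hm.
    by rewrite ler_pdivrMr ?expr2n_gt0 //; apply: le_trans h1; rewrite ler_int.
  rewrite ler_pdivlMr ?expr2n_gt0 //; apply: le_trans h2 _.
  by rewrite ler_int; lia.
case: e d fE gE => [] [] fE gE.
- exists true, (Order.max b c) => s hs; rewrite (fE _ hs) (gE _ hs).
  by case: (leP b c) => h; [rewrite max_r | rewrite max_l] => //;
     rewrite lerD2r ler_pM2r // ler_int // ltW.
- exists (~~ (b - c <= k)), (if b - c <= k then c else b) => s hs.
  have := cross (b - c) s hs; rewrite (fE _ hs) (gE _ hs).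
  rewrite rmorphB /= mulrBl.
  by case: ifP => _ h; [rewrite max_r | rewrite max_l] => /=; lra.
- exists (~~ (c - b <= k)), (if c - b <= k then b else c) => s hs.
  have := cross (c - b) s hs; rewrite (fE _ hs) (gE _ hs).
  rewrite rmorphB /= mulrBl.
  by case: ifP => _ h; [rewrite max_l | rewrite max_r] => /=; lra.
- exists false, (Order.max b c) => s hs; rewrite (fE _ hs) (gE _ hs).
  by case: (leP b c) => h; [rewrite max_r | rewrite max_l] => //;
     rewrite lerD2r ler_pM2r // ler_int // ltW.
Qed.

(** The grid is refined until [z] lies on it; the constant [f z] taken past [z] is then a grid value
    too. *)
Lemma wall_like_freeze f z : dyadic z -> wall_like f ->
  wall_like (fun t => if t <= z then f t else f z).
Proof.
move=> /dyadicP[M zM] [anti [N pw]]; split=> [s t le_st|].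
  have [sz|sz] := leP s z; have [tz|tz] := leP t z; try lra; first exact: anti.
  by have := anti _ _ sz; lra.
have {}pw := piecewiseW (leq_maxl N M) pw.
have {zM} := int_expr2nW (leq_maxr N M) zM.
exists (maxn N M) => k; move: (maxn N M) pw H => {}N pw /intrP[m zm].
have pos := expr2n_gt0 N.
have [lt_km|le_mk] := ltP k m.
  have [e [b fE]] := pw k; exists e, b => s hs; rewrite -fE //.
  have -> // : s <= z; rewrite -(ler_pM2r pos) zm.
  by case/andP: hs => _ h; apply: le_trans h _; rewrite ler_int; lia.
have [e [b fE]] := pw m; exists false, (if e then b - m else b) => s /andP[hs _].
have z_s : z <= s by rewrite -(ler_pM2r pos) zm; apply: le_trans hs; rewrite ler_int.
have -> : (if s <= z then f s else f z) = f z.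
  by case: ifP => // h; congr f; apply/eqP; rewrite eq_le h z_s.
rewrite fE ?zm ?lexx ?ler_int; last lia.
case: e {fE} => //; rewrite intrB mulrBl -zm mulfK ?expr2n_neq0 //; lra.
Qed.

Lemma wall_like_dyadic f t : wall_like f -> dyadic t -> dyadic (f t).
Proof.
case=> _ [N pw] ht; have [e [b fE]] := pw (Num.floor (t * 2 ^+ N)).
rewrite fE; last by rewrite floor_le ltW ?floorD1_gt.
apply: dyadicB; first by exists b, N.
by case: e {fE} => //; exact: (dyadic_int 0).
Qed.

(** Existence of the temperature, with [f] the left tilde wall and [h] the opposite of the right
    one. On the cell ending at the first grid point where [f + h] is at most 0, the sum is affine of
    slope -1 or -2, so its zero is dyadic. *)
Lemma wall_like_zero f h T : wall_like f -> wall_like h ->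
  0 < f (-1) + h (-1) -> f T + h T <= 0 ->
  exists z, [/\ dyadic z, -1 < z, f z + h z = 0 & forall s : rat, s < z -> 0 < f s + h s].
Proof.
move=> [fa [M fp]] [ha [N hp]] pos0 negT.
have {}fp := piecewiseW (leq_maxl M N) fp; have {}hp := piecewiseW (leq_maxr M N) hp.
move: (maxn M N) fp hp => {M}N fp hp.
have anti (s t : rat) : s <= t -> f t + h t <= f s + h s.
  by move=> le_st; have := fa _ _ le_st; have := ha _ _ le_st; lra.
have pos := expr2n_gt0 N.
(* The grid points are counted from -1, where positivity is given. *)
pose x (j : nat) : rat := j%:R / 2 ^+ N - 1.
have : exists j, f (x j) + h (x j) <= 0.
  exists (Num.bound `|T + 1|%R * 2 ^ N)%N; apply: le_trans negT; apply: anti.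
  rewrite /x natrM natrX mulfK ?expr2n_neq0 //.
  have := archi_boundP (normr_ge0 (T + 1)); have := ler_norm (T + 1); lra.
case/ex_minnP => -[|i] gj minj.
  by move: gj; rewrite /x mul0r sub0r; lra.
have gi : 0 < f (x i) + h (x i) by rewrite ltNge; apply/negP => /minj; rewrite ltnn.
have xM (j : nat) : x j * 2 ^+ N = (j%:Z - 2 ^+ N)%:~R.
  by rewrite /x mulrBl mulfVK ?expr2n_neq0 // mul1r intrB rmorphXn.
have [e [b fE]] := fp (i%:Z - 2 ^+ N); have [d [c hE]] := hp (i%:Z - 2 ^+ N).
have cell (s : rat) : x i <= s <= x i.+1 ->
    (i%:Z - 2 ^+ N)%:~R <= s * 2 ^+ N <= (i%:Z - 2 ^+ N + 1)%:~R.
  have -> : i%:Z - 2 ^+ N + 1 = i.+1%:Z - 2 ^+ N by lia.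
  by rewrite -!xM !ler_pM2r.
have x_lt : x i < x i.+1 by rewrite -(ltr_pM2r pos) !xM ltr_int; lia.
have {}fE (s : rat) : x i <= s <= x i.+1 -> f s = _ := fun h => fE s (cell s h).
have {}hE (s : rat) : x i <= s <= x i.+1 -> h s = _ := fun h => hE s (cell s h).
have dy : dyadic ((b + c)%:~R / 2 ^+ N) by exists (b + c), N.
set y := _ / _ in dy.
have gE (s : rat) : x i <= s <= x i.+1 ->
    f s + h s = y - (if e then s else 0) - (if d then s else 0).
  by move=> hs; rewrite (fE _ hs) (hE _ hs) /y intrD mulrDl; lra.
(* With both slopes equal to -1 the zero solves [y = 2 * s] and may lie halfway between grid points;
   total slope 0 is excluded by the change of sign. *)
exists (if e && d then y / 2 else y).
have gi' := gE (x i); have gj' := gE (x i.+1).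
have : x i <= x i <= x i.+1 by lra.
move/gi' => {}gi'; have : x i <= x i.+1 <= x i.+1 by lra.
move/gj' => {}gj'.
have x0 : -1 <= x i.
  have : 0 <= i%:R / 2 ^+ N :> rat by rewrite divr_ge0 // ltW.
  by rewrite /x; lra.
split.
- by case: ifP => // _; exact: dyadic_half.
- by move: gi' gj'; case: e {fE gE}; case: d {hE} => /=; lra.
- by rewrite gE; move: gi' gj'; case: e {fE gE}; case: d {hE} => /=; lra.
move=> s lt_s; have [le_sx|lt_xs] := leP s (x i); first by have := anti _ _ le_sx; lra.
by rewrite gE; move: lt_s gi' gj'; case: e {fE gE}; case: d {hE} => /=; lra.
Qed.

(** * Maxima and minima of lists *)

Lemma bigmaxP (a : rat) (s : seq rat) :
  (forall x, x \in a :: s -> x <= \big[Order.max/a]_(y <- s) y) /\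
  \big[Order.max/a]_(y <- s) y \in a :: s.
Proof.
elim: s => [|y s [IH1 IH2]].
  by rewrite big_nil mem_head; split=> // x; rewrite inE => /eqP ->.
rewrite big_cons; split.
  move=> x; rewrite !inE le_max => /or3P[/eqP->|/eqP->|hx].
  - by rewrite IH1 ?mem_head ?orbT.
  - by rewrite lexx.
  - by rewrite IH1 ?orbT // inE hx orbT.
by case: (leP y) => _; rewrite !inE ?eqxx ?orbT //; move: IH2;
  rewrite inE => /orP[]->; rewrite ?orbT.
Qed.

Lemma seq_max_mem s : s != [::] -> seq_max s \in s.
Proof.
case: s => // a s _; rewrite /seq_max /=; have [_] := bigmaxP a (a :: s).
by rewrite inE => /orP[/eqP->|//]; rewrite mem_head.
Qed.

Lemma seq_max_ge s x : x \in s -> x <= seq_max s.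
Proof. by case: s => // a s hx; apply: (bigmaxP a (a :: s)).1; rewrite inE hx orbT. Qed.

Lemma seq_minN s : seq_min s = - seq_max [seq - x | x <- s].
Proof.
rewrite /seq_min /seq_max; have -> : head 0 [seq - x | x <- s] = - head 0 s.
  by case: s => //=; rewrite oppr0.
rewrite big_map; apply: (big_rec2 (fun x y => x = - y)); rewrite ?opprK // => x y1 y2 _ ->.
by rewrite oppr_max opprK.
Qed.

Lemma seq_min_mem s : s != [::] -> seq_min s \in s.
Proof.
move=> s0; rewrite seq_minN; have : seq_max [seq - x | x <- s] \in [seq - x | x <- s].
  by apply: seq_max_mem; case: s s0.
by case/mapP=> x hx ->; rewrite opprK.
Qed.

Lemma seq_min_le s x : x \in s -> seq_min s <= x.
Proof. by move=> hx; rewrite seq_minN lerNl; apply: seq_max_ge; rewrite map_f. Qed.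

Lemma wall_like_seq_max (I : eqType) (F : I -> rat -> rat) (s : seq I) : s != [::] ->
  (forall X, X \in s -> wall_like (F X)) ->
  wall_like (fun t => seq_max [seq F X t | X <- s]).
Proof.
case: s => // X0 s _ hF; rewrite /seq_max /=.
under boolp.eq_fun do rewrite -map_cons big_map.
have hX0 := hF X0 (mem_head _ _).
elim: (X0 :: s) hF => [_|Y s' IH hF].
  by under boolp.eq_fun do rewrite big_nil.
under boolp.eq_fun do rewrite big_cons.
apply: wall_like_max; first by apply: hF; exact: mem_head.
by apply: IH => X hX; apply: hF; rewrite inE hX orbT.
Qed.

(** * Walls of games *)

Definition left_tilde (t : rat) (G : game) : rat :=
  seq_max [seq right_wall t X - t | X <- lopts G].
Definition right_tilde (t : rat) (G : game) : rat :=
  seq_min [seq left_wall t X + t | X <- ropts G].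
Definition freezing (G : game) : rat :=
  dyadic_min (fun t => left_tilde t G = right_tilde t G).
Definition cool_tilde (t : rat) (G : game) : game :=
  Game [seq game_sub (cool t X) (num_game t) | X <- lopts G]
       [seq game_add (cool t X) (num_game t) | X <- ropts G].

Lemma cooling_of_integer G : is_integer_game G ->
  cooling_of G = integer_cooling (integer_value G).
Proof. by case: G => GL GR int /=; rewrite asboolT. Qed.

Lemma integer_valueP G : is_integer_game G -> game_eqv G (int_game (integer_value G)).
Proof.
move=> [n hn].
exact: (xgetPex 0 (ex_intro (fun n => game_eqv G (int_game n)) n hn)).
Qed.

Lemma wallsE_integer t G : is_integer_game G ->
  [/\ left_wall t G = (integer_value G)%:~R, right_wall t G = (integer_value G)%:~R &
      cool t G = int_game (integer_value G)].
Proof. by move=> /cooling_of_integer; rewrite /left_wall /right_wall /cool => ->. Qed.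

Lemma wallsE t G : ~ is_integer_game G ->
  [/\ left_wall t G = if t <= freezing G then left_tilde t G else left_tilde (freezing G) G,
      right_wall t G = if t <= freezing G then right_tilde t G else left_tilde (freezing G) G &
      cool t G = if t <= freezing G then cool_tilde t G
                 else num_game (left_tilde (freezing G) G)].
Proof.
move=> nint.
have lE s : seq_max [seq cooling_rho T s - s | T <- map cooling_of (lopts G)] = left_tilde s G.
  by rewrite -map_comp.
have rE s : seq_min [seq cooling_lambda T s + s | T <- map cooling_of (ropts G)] = right_tilde s G.
  by rewrite -map_comp.
have tE : dyadic_min (fun t => seq_max [seq cooling_rho T t - t | T <- map cooling_of (lopts G)]
    = seq_min [seq cooling_lambda T t + t | T <- map cooling_of (ropts G)]) = freezing G.
  by congr dyadic_min; apply/funext => s; rewrite lE rE.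
rewrite /left_wall /right_wall /cool.
have -> : cooling_of G =
    noninteger_cooling (map cooling_of (lopts G)) (map cooling_of (ropts G)).
  by case: (G) nint => GL GR nint /=; rewrite asboolF.
rewrite /noninteger_cooling /= tE !lE rE; split=> //.
by case: ifP => // _; rewrite /cool_tilde -!map_comp.
Qed.

Lemma dyadic_minE (P : rat -> Prop) z : dyadic z -> P z ->
  (forall s, dyadic s -> P s -> z <= s) -> dyadic_min P = z.
Proof.
move=> dz Pz zmin.
have [d1 P1 min1] := xgetPex 0 (ex_intro (fun s => [/\ dyadic s, P s &
                   forall s', dyadic s' -> P s' -> s <= s']) z (And3 dz Pz zmin)).
by apply/eqP; rewrite eq_le min1 //= zmin.
Qed.

(* This is what makes every temperature exceed -1. *)
Definition integer_bounds (G : game) := exists l r : int,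
  [/\ left_wall (-1) G = l%:~R, right_wall (-1) G = r%:~R,
      forall n, game_ge G (int_game n) = (n <= r) &
      forall n, game_ge (int_game n) G = (l <= n)].

(** Against bounded walls of the options the growing tax eventually prevails, which makes the tilde
    walls cross. *)
Definition bounded_below (f : rat -> rat) := exists m, forall t, m <= f t.

Definition walls_regular (G : game) :=
  [/\ wall_like (left_wall ^~ G), wall_like (fun t => - right_wall t G),
      bounded_below (left_wall ^~ G), bounded_below (fun t => - right_wall t G) &
      integer_bounds G].

Definition freezing_spec (G : game) :=
  [/\ dyadic (freezing G), -1 < freezing G,
      left_tilde (freezing G) G = right_tilde (freezing G) G &
      forall s : rat, s < freezing G -> right_tilde s G < left_tilde s G].

Lemma common_lower_bound (R : realDomainType) (Q : game -> R -> Prop) (s : seq game) :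
  (forall X, X \in s -> exists m, forall n, n <= m -> Q X n) ->
  exists m, forall X, X \in s -> Q X m.
Proof.
move=> hQ; suff [m hm] : exists m : R, forall X n, X \in s -> n <= m -> Q X n.
  by exists m => X hX; apply: hm.
elim: s hQ => [|Y s IH] hQ; first by exists 0.
have [m1 h1] := hQ Y (mem_head _ _).
have [|m2 h2] := IH; first by move=> X hX; apply: hQ; rewrite inE hX orbT.
exists (Order.min m1 m2) => X n; rewrite inE le_min => /orP[/eqP-> | hX] /andP[? ?].
  exact: h1.
exact: h2.
Qed.

Section NonintegerStep.
Variable G : game.
Hypothesis nint : ~ is_integer_game G.
Hypothesis regL : forall X, X \in lopts G -> walls_regular X.
Hypothesis regR : forall X, X \in ropts G -> walls_regular X.

(** Without Left options, any sufficiently small integer fits and simplicity makes [G] an integer.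
    This keeps [seq_max] away from its default 0. *)
Lemma lopts_neq0 : lopts G != [::].
Proof.
apply/eqP => L0; case: (@common_lower_bound int (fun X n => game_gf X (int_game n)) (ropts G)).
  move=> X /regR[_ _ _ _ [l [r [_ _ _ h]]]]; exists (l - 1) => n le_n.
  by rewrite /game_gf h -ltNge; lia.
by move=> m hm; apply: nint; apply: (@simplest_integer m) => // X; rewrite L0.
Qed.

Lemma ropts_neq0 : ropts G != [::].
Proof.
apply/eqP => R0.
case: (@common_lower_bound int (fun X n => game_gf (int_game (- n)) X) (lopts G)).
  move=> X /regL[_ _ _ _ [l [r [_ _ h _]]]]; exists (- r - 1) => n le_n.
  by rewrite /game_gf h -ltNge; lia.
by move=> m hm; apply: nint; apply: (@simplest_integer (- m)) => // X; rewrite R0.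
Qed.

Lemma left_tilde_ge t X : X \in lopts G -> right_wall t X - t <= left_tilde t G.
Proof. by move=> hX; apply: seq_max_ge; apply/mapP; exists X. Qed.

Lemma right_tilde_le t X : X \in ropts G -> right_tilde t G <= left_wall t X + t.
Proof. by move=> hX; apply: seq_min_le; apply/mapP; exists X. Qed.

Lemma left_tildeP t : exists2 X, X \in lopts G & left_tilde t G = right_wall t X - t.
Proof.
apply/mapP; apply: seq_max_mem; rewrite -size_eq0 size_map size_eq0.
exact: lopts_neq0.
Qed.

Lemma right_tildeP t : exists2 X, X \in ropts G & right_tilde t G = left_wall t X + t.
Proof.
apply/mapP; apply: seq_min_mem; rewrite -size_eq0 size_map size_eq0.
exact: ropts_neq0.
Qed.

Lemma wall_like_left_tilde : wall_like (left_tilde ^~ G).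
Proof.
apply: (@wall_like_seq_max _ (fun X t => right_wall t X - t)); first exact: lopts_neq0.
move=> X /regL[_ /wall_like_flip + _ _ _].
by under boolp.eq_fun do rewrite opprK.
Qed.

Lemma wall_like_right_tilde : wall_like (fun t => - right_tilde t G).
Proof.
have -> : (fun t => - right_tilde t G) =
    (fun t => seq_max [seq - left_wall t X - t | X <- ropts G]).
  apply/funext => t; rewrite /right_tilde seq_minN opprK -map_comp.
  by congr seq_max; apply: eq_map => X /=; rewrite opprD.
apply: (@wall_like_seq_max _ (fun X t => - left_wall t X - t)); first exact: ropts_neq0.
by move=> X /regR[/wall_like_flip].
Qed.

(** By integer avoidance, [n] is at least [G] iff no Left option is at least [n], that is iff $n \ge
    r_X + 1$ for every Left option $X$ with best lower integer bound $r_X$. The tax -1 adds exactly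
    this 1; dually for Right. *)
Lemma integer_bounds_tilde : exists l r : int,
  [/\ left_tilde (-1) G = l%:~R, right_tilde (-1) G = r%:~R,
      forall n, game_ge G (int_game n) = (n <= r) &
      forall n, game_ge (int_game n) G = (l <= n)].
Proof.
have [X hX eX] := left_tildeP (-1); have [Y hY eY] := right_tildeP (-1).
have [_ _ _ _ [lX [rX [_ rXE geX leX]]]] := regL hX.
have [_ _ _ _ [lY [rY [lYE _ geY leY]]]] := regR hY.
exists (rX + 1), (lY - 1); split.
- by rewrite eX rXE intrD opprK.
- by rewrite eY lYE intrB.
- move=> n; apply/idP/idP => [ge|le_n].
    by have := game_gf_ropts ge hY; rewrite /game_gf leY -ltNge; lia.
  apply: integer_avoidance_ge => // Z hZ.
  have [_ _ _ _ [lZ [rZ [lZE _ _ leZ]]]] := regR hZ.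
  rewrite /game_gf leZ -ltNge; have := right_tilde_le (-1) hZ.
  by rewrite eY lYE lZE lerD2r ler_int; lia.
move=> n; apply/idP/idP => [ge|le_n].
  by have := game_gf_lopts ge hX; rewrite /game_gf geX -ltNge; lia.
apply: integer_avoidance_le => // Z hZ.
have [_ _ _ _ [lZ [rZ [_ rZE geZ _]]]] := regL hZ.
rewrite /game_gf geZ -ltNge; have := left_tilde_ge (-1) hZ.
by rewrite eX rXE rZE lerD2r ler_int; lia.
Qed.

Lemma freezing_spec_step : freezing_spec G.
Proof.
have wl := wall_like_left_tilde; have wr := wall_like_right_tilde.
have [m1 hm1] : exists m1 : rat, forall X, X \in lopts G -> forall t, m1 <= - right_wall t X.
  apply: common_lower_bound => X /regL[_ _ _ [m hm] _].
  by exists m => n le_n t; apply: le_trans (hm t).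
have [m2 hm2] : exists m2 : rat, forall X, X \in ropts G -> forall t, m2 <= left_wall t X.
  apply: common_lower_bound => X /regR[_ _ [m hm] _ _].
  by exists m => n le_n t; apply: le_trans (hm t).
have [l [r [lE rE geG leG]]] := integer_bounds_tilde.
have lt_rl : r < l.
  rewrite ltNge; apply/negP => le_lr; apply: nint.
  by exists l; rewrite /game_eqv geG leG le_lr lexx.
have pos : 0 < left_tilde (-1) G + - right_tilde (-1) G by rewrite lE rE subr_gt0 ltr_int.
(* At tax [T] the left tilde wall is at most [- m1 - T] and the right one at least [m2 + T], so this
   [T] is large enough. *)
have neg : left_tilde (`|m1| + `|m2|) G + - right_tilde (`|m1| + `|m2|) G <= 0.
  move TE : (`|m1| + `|m2|) => T.
  have [X hX ->] := left_tildeP T; have [Y hY ->] := right_tildeP T.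
  have := hm1 _ hX T; have := hm2 _ hY T.
  move: (right_wall T X) (left_wall T Y) => x y.
  have := ler_norm (- m1); have := ler_norm (- m2); rewrite !normrN.
  by have := normr_ge0 m1; have := normr_ge0 m2; lra.
have [z [dz z_gt z0 z_lt]] := wall_like_zero wl wr pos neg.
have zE : freezing G = z.
  apply: dyadic_minE => //; first lra.
  move=> s ds es; rewrite leNgt; apply/negP => /z_lt; lra.
by split; rewrite ?zE //; [lra | move=> s /z_lt; lra].
Qed.

Lemma walls_regular_step : walls_regular G.
Proof.
have [dz z_gt zE z_lt] := freezing_spec_step.
have wl := wall_like_freeze dz wall_like_left_tilde.
have wr := wall_like_freeze dz wall_like_right_tilde.
have eL : left_wall ^~ G =
    (fun t => if t <= freezing G then left_tilde t G else left_tilde (freezing G) G).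
  by apply/funext => t; have [] := wallsE t nint.
have eR : (fun t => - right_wall t G) =
    (fun t => if t <= freezing G then - right_tilde t G else - right_tilde (freezing G) G).
  by apply/funext => t; have [_ -> _] := wallsE t nint; rewrite zE; case: ifP.
split; rewrite /= ?eL ?eR //.
- exists (left_tilde (freezing G) G) => t /=; case: ifP => // le_t.
  by have := wall_like_left_tilde.1 _ _ le_t; lra.
- exists (- right_tilde (freezing G) G) => t /=; case: ifP => // le_t.
  by have := wall_like_right_tilde.1 _ _ le_t; lra.
have [l [r [lE rE geG leG]]] := integer_bounds_tilde; exists l, r.
by have [-> -> _] := wallsE (-1) nint; rewrite ltW.
Qed.

End NonintegerStep.

Lemma walls_regular_integer G : is_integer_game G -> walls_regular G.
Proof.
move=> int; have E t := wallsE_integer t int.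
have [h1 h2] := andP (integer_valueP int); move: (integer_value G) => n in E h1 h2 *.
split.
- rewrite (_ : left_wall ^~ G = fun=> n%:~R); first exact: wall_like_cst.
  by apply/funext => t; have [] := E t.
- rewrite (_ : (fun t => _) = fun=> (- n)%:~R); first exact: wall_like_cst.
  by apply/funext => t; have [_ -> _] := E t; rewrite intrN.
- by exists n%:~R => t; have [-> _ _] := E t.
- by exists (- n%:~R) => t; have [_ -> _] := E t.
exists n, n; have [-> -> _] := E (-1); split=> // m; rewrite -[RHS]game_ge_int.
  by apply/idP/idP; apply: game_ge_trans.
by apply/idP/idP => /game_ge_trans; apply.
Qed.

Lemma walls_regularP G : walls_regular G.
Proof.
elim/game_rect_opts: G => G IHL IHR.
have [/walls_regular_integer //|nint] := pselect (is_integer_game G).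
exact: walls_regular_step.
Qed.

(** * Cooled games *)

Lemma freezing_specP G : ~ is_integer_game G -> freezing_spec G.
Proof. by move=> nint; apply: freezing_spec_step => // X _; exact: walls_regularP. Qed.

Lemma left_wall_anti G s t : s <= t ->
  left_wall t G <= left_wall s G <= left_wall t G + (t - s).
Proof. by have [[h _] _ _ _ _] := walls_regularP G; exact: h. Qed.

Lemma right_wall_homo G s t : s <= t ->
  right_wall s G <= right_wall t G <= right_wall s G + (t - s).
Proof. by have [_ [h _] _ _ _] := walls_regularP G; move/h; lra. Qed.

Lemma dyadic_left_wall t G : dyadic t -> dyadic (left_wall t G).
Proof. by have [h _ _ _ _] := walls_regularP G; exact: wall_like_dyadic h. Qed.

Lemma dyadic_right_wall t G : dyadic t -> dyadic (right_wall t G).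
Proof.
have [_ h _ _ _] := walls_regularP G; move/(wall_like_dyadic h)/dyadicN.
by rewrite opprK.
Qed.

(** The regime, temperature included, in which [cool t G] is built from the cooled options.
    Otherwise it is a canonical number, as always for a game equal to an integer. *)
Definition hot (t : rat) (G : game) := ~ is_integer_game G /\ t <= freezing G.

Lemma hotW s t G : s <= t -> hot t G -> hot s G.
Proof. by move=> le_st [nint le_t]; split=> //; exact: le_trans le_t. Qed.

Lemma hotE t G : hot t G ->
  [/\ left_wall t G = left_tilde t G, right_wall t G = right_tilde t G &
      cool t G = cool_tilde t G].
Proof. by move=> [nint le_t]; have := wallsE t nint; rewrite le_t. Qed.

Lemma not_hotE t G : ~ hot t G ->
  right_wall t G = left_wall t G /\ cool t G = num_game (left_wall t G).
Proof.
move=> nhot; have [int|nint] := pselect (is_integer_game G).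
  by have [-> -> ->] := wallsE_integer t int; rewrite num_game_int.
by have [-> -> ->] := wallsE t nint; case: ifP => // le_t; case: nhot.
Qed.

Lemma hot_left_tildeP t G : hot t G ->
  exists2 X, X \in lopts G & left_wall t G = right_wall t X - t.
Proof.
by move=> /[dup] /hotE[-> _ _] [nint _]; apply: left_tildeP => // X _; exact: walls_regularP.
Qed.

Lemma hot_right_tildeP t G : hot t G ->
  exists2 X, X \in ropts G & right_wall t G = left_wall t X + t.
Proof.
by move=> /[dup] /hotE[_ -> _] [nint _]; apply: right_tildeP => // X _; exact: walls_regularP.
Qed.

Lemma hot_left_wall_ge t G X : hot t G -> X \in lopts G ->
  right_wall t X - t <= left_wall t G.
Proof. by move=> /hotE[-> _ _]; exact: left_tilde_ge. Qed.

Lemma hot_right_wall_le t G X : hot t G -> X \in ropts G ->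
  right_wall t G <= left_wall t X + t.
Proof. by move=> /hotE[_ -> _]; exact: right_tilde_le. Qed.

Lemma right_wall_le_left t G : right_wall t G <= left_wall t G.
Proof.
have [h|/not_hotE[-> _] //] := pselect (hot t G).
have [-> -> _] := hotE h; case: h => nint; have [_ _ zE z_lt] := freezing_specP nint.
by rewrite le_eqVlt => /orP[/eqP-> | /z_lt/ltW //]; rewrite zE.
Qed.

Lemma lopts_cool t G X : hot t G -> X \in lopts (cool t G) ->
  exists2 Y, Y \in lopts G & X = game_sub (cool t Y) (num_game t).
Proof. by move=> /hotE[_ _ ->] /mapP. Qed.

Lemma ropts_cool t G X : hot t G -> X \in ropts (cool t G) ->
  exists2 Y, Y \in ropts G & X = game_add (cool t Y) (num_game t).
Proof. by move=> /hotE[_ _ ->] /mapP. Qed.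

Lemma cool_lopts t G X : hot t G -> X \in lopts G ->
  game_sub (cool t X) (num_game t) \in lopts (cool t G).
Proof. by move=> /hotE[_ _ ->] hX; apply/mapP; exists X. Qed.

Lemma cool_ropts t G X : hot t G -> X \in ropts G ->
  game_add (cool t X) (num_game t) \in ropts (cool t G).
Proof. by move=> /hotE[_ _ ->] hX; apply/mapP; exists X. Qed.

(** * Symmetry under negation *)

Lemma integer_valueE G n : game_eqv G (int_game n) -> integer_value G = n.
Proof.
move=> e; have /andP[h1 h2] := integer_valueP (ex_intro _ n e).
case/andP: e => h3 h4; apply/eqP; rewrite eq_le -!game_ge_int.
by rewrite (game_ge_trans h4 h1) (game_ge_trans h2 h3).
Qed.

Lemma left_tilde_opp s G :
  (forall X, X \in ropts G -> right_wall s (game_opp X) = - left_wall s X) ->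
  left_tilde s (game_opp G) = - right_tilde s G.
Proof.
move=> h; rewrite /left_tilde /right_tilde seq_minN opprK lopts_opp -!map_comp.
by congr seq_max; apply/eq_in_map => X /= /h ->; rewrite opprD.
Qed.

Lemma right_tilde_opp s G :
  (forall X, X \in lopts G -> left_wall s (game_opp X) = - right_wall s X) ->
  right_tilde s (game_opp G) = - left_tilde s G.
Proof.
move=> h; rewrite /left_tilde /right_tilde seq_minN ropts_opp -!map_comp.
by congr (- seq_max _); apply/eq_in_map => X /= /h ->; rewrite opprD !opprK.
Qed.

Lemma freezing_opp_tilde G :
  (forall s, left_tilde s (game_opp G) = - right_tilde s G) ->
  (forall s, right_tilde s (game_opp G) = - left_tilde s G) ->
  freezing (game_opp G) = freezing G.
Proof.
move=> lE rE; congr dyadic_min; apply/funext => s; apply/propext.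
by rewrite lE rE; split=> [/oppr_inj|->].
Qed.

(** The tilde walls of the negative are the exchanged opposites, so they meet at the same points and
    the temperature is kept. Comparisons with numbers can then be proved on one side and
    transferred. *)
Lemma walls_opp G t :
  left_wall t (game_opp G) = - right_wall t G /\
  right_wall t (game_opp G) = - left_wall t G.
Proof.
elim/game_rect_opts: G t => G IHL IHR t.
have [int|nint] := pselect (is_integer_game G).
  have intN := (is_integer_gameN G).2 int.
  have [-> -> _] := wallsE_integer t int; have [-> -> _] := wallsE_integer t intN.
  rewrite (@integer_valueE _ (- integer_value G)) ?intrN //.
  by rewrite -game_opp_int /game_eqv !game_ge_opp andbC; exact: integer_valueP.
have nintN : ~ is_integer_game (game_opp G) by rewrite is_integer_gameN.
have lE s : left_tilde s (game_opp G) = - right_tilde s G.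
  by apply: left_tilde_opp => X /IHR /(_ s)[].
have rE s : right_tilde s (game_opp G) = - left_tilde s G.
  by apply: right_tilde_opp => X /IHL /(_ s)[].
have [_ _ eqz _] := freezing_specP nint.
have [-> -> _] := wallsE t nint; have [-> -> _] := wallsE t nintN.
by rewrite freezing_opp_tilde // !lE rE -eqz; case: ifP.
Qed.

Lemma left_wall_opp t G : left_wall t (game_opp G) = - right_wall t G.
Proof. exact: (walls_opp G t).1. Qed.

Lemma right_wall_opp t G : right_wall t (game_opp G) = - left_wall t G.
Proof. exact: (walls_opp G t).2. Qed.

Lemma freezing_opp G : freezing (game_opp G) = freezing G.
Proof.
apply: freezing_opp_tilde => s.
  by apply: left_tilde_opp => X _; exact: right_wall_opp.
by apply: right_tilde_opp => X _; exact: left_wall_opp.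
Qed.

Lemma hot_opp t G : hot t (game_opp G) <-> hot t G.
Proof. by rewrite /hot is_integer_gameN freezing_opp. Qed.

Lemma cool_opp t G : dyadic t -> cool t (game_opp G) = game_opp (cool t G).
Proof.
move=> ht; elim/game_rect_opts: G => G IHL IHR.
have [h|h] := pselect (hot t G); last first.
  have [e ->] := not_hotE h; have := h; rewrite -hot_opp => /not_hotE[_ ->].
  by rewrite left_wall_opp e game_opp_num //; exact: dyadic_left_wall.
have [_ _ ->] := hotE h; have := h; rewrite -hot_opp => /hotE[_ _ ->].
rewrite /cool_tilde lopts_opp ropts_opp /= -!map_comp.
congr Game; apply/eq_in_map => X /=.
  by move=> /IHR ->; rewrite game_oppD.
by move=> /IHL ->; rewrite /game_sub game_oppD game_oppK.
Qed.

(** * Cooled games against numbers *)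

(** The walls act as the stops of the cooled game, and each half passes to the other at an option.
    The inequalities are strict because on the wall itself an infinitesimal decides. *)
Lemma cool_num_ge t : dyadic t -> forall G x, dyadic x ->
  (x < right_wall t G -> game_ge (cool t G) (num_game x)) /\
  (x < left_wall t G -> game_gf (cool t G) (num_game x)).
Proof.
move=> ht; elim/game_rect_opts => G IHL IHR x hx.
have [h|/not_hotE[-> ->]] := pselect (hot t G); last first.
  have dl := dyadic_left_wall G ht.
  by rewrite /game_gf !game_ge_num // -ltNge; split=> // /ltW.
have gf y : dyadic y -> y < left_wall t G -> game_gf (cool t G) (num_game y).
  move=> hy; have [X hX ->] := hot_left_tildeP h => lt_y.
  apply/game_gfP; left; exists (game_sub (cool t X) (num_game t)).
    exact: cool_lopts.
  rewrite sub_num_ge //; apply: (IHL _ hX _ _).1; first exact: dyadicD.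
  lra.
split; last exact: gf.
move=> lt_x; apply/game_geP; split=> Z.
  move=> /(ropts_cool h)[X hX ->]; rewrite num_ge_add //.
  apply: (IHR _ hX _ _).2; first exact: dyadicB.
  by have := hot_right_wall_le h hX; lra.
(* A Left option of [x] is a smaller number, hence still below the right wall and so below the left
   one: the second half applies to the same [G]. *)
move=> /(lopts_num hx)[z [-> _ hz lt_z]]; apply: gf => //.
by have := right_wall_le_left t G; lra.
Qed.

Lemma cool_ge_num t G x : dyadic t -> dyadic x ->
  x < right_wall t G -> game_ge (cool t G) (num_game x).
Proof. by move=> ht hx; exact: (cool_num_ge ht G hx).1. Qed.

Lemma cool_gf_num t G x : dyadic t -> dyadic x ->
  x < left_wall t G -> game_gf (cool t G) (num_game x).
Proof. by move=> ht hx; exact: (cool_num_ge ht G hx).2. Qed.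

Lemma num_ge_cool t G x : dyadic t -> dyadic x ->
  left_wall t G < x -> game_ge (num_game x) (cool t G).
Proof.
move=> ht hx lt_x; rewrite -game_ge_opp -cool_opp // game_opp_num //.
by apply: cool_ge_num; rewrite ?right_wall_opp ?ltrN2 //; exact: dyadicN.
Qed.

Lemma num_gf_cool t G x : dyadic t -> dyadic x ->
  right_wall t G < x -> game_gf (num_game x) (cool t G).
Proof.
move=> ht hx lt_x; rewrite -game_gf_opp -cool_opp // game_opp_num //.
by apply: cool_gf_num; rewrite ?left_wall_opp ?ltrN2 //; exact: dyadicN.
Qed.

(* G_t and its wall differ by an infinitesimal only; the slope of the wall just
   below [t] determines its sign. *)
Lemma wall_slope_sign t : dyadic t -> forall G s, s < t ->
  (right_wall t G = right_wall s G + (t - s) ->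
     game_gf (num_game (right_wall t G)) (cool t G)) /\
  (left_wall t G = left_wall s G ->
     game_ge (num_game (left_wall t G)) (cool t G)).
Proof.
move=> ht; elim/game_rect_opts => G IHL IHR s lt_st.
have dl := dyadic_left_wall G ht; have dr := dyadic_right_wall G ht.
have [h|h] := pselect (hot t G); last first.
  split; last by have [_ ->] := not_hotE h; rewrite game_ge_refl.
  (* The right wall is constant above the temperature, and everywhere for an integer, so it cannot
     have risen with slope 1 all the way up to [t]. *)
  move=> slope; exfalso.
  have [int|nint] := pselect (is_integer_game G).
    move: slope; have [_ -> _] := wallsE_integer t int.
    by have [_ -> _] := wallsE_integer s int; lra.
  have lt_zt : freezing G < t.
    by rewrite ltNge; apply/negP => le_tz; apply: h.
  move: slope; have [_ _ zE _] := freezing_specP nint.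
  have [_ -> _] := wallsE t nint; rewrite leNgt lt_zt /=.
  have [_ eqz _] := wallsE (freezing G) nint; rewrite lexx -zE in eqz; rewrite -eqz.
  have [le_sz|lt_zs] := leP s (freezing G).
    by have := right_wall_homo G le_sz; lra.
  by have [_ -> _] := wallsE s nint; rewrite leNgt lt_zs /= -eqz; lra.
have hs : hot s G by apply: hotW h; exact: ltW.
split=> slope.
  (* [X] attains the right wall at [s]. Full slope for [G], while the left wall of [X] cannot rise,
     forces that wall to be flat and [X] to be optimal at [t] as well. *)
  have [X hX eX] := hot_right_tildeP hs; have le_X := hot_right_wall_le h hX.
  have anti := left_wall_anti X (ltW lt_st).
  have flat : left_wall t X = left_wall s X by lra.
  apply/game_gfP; right; exists (game_add (cool t X) (num_game t)); first exact: cool_ropts.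
  have eq_t : right_wall t G - t = left_wall t X by lra.
  rewrite num_ge_add // eq_t.
  exact: (IHR _ hX _ lt_st).2.
apply/game_geP; split=> Z.
  move=> /(ropts_num dl)[z [-> _ hz lt_z]]; apply: num_gf_cool => //.
  by have := right_wall_le_left t G; lra.
move=> /(lopts_cool h)[X hX ->]; rewrite sub_num_ge //.
(* A non-optimal [X] leaves room for a strict comparison. If [X] is optimal at [t], flatness of the
   left wall of [G] makes the right wall of [X] rise with slope 1, and the induction breaks the
   tie. *)
have := hot_left_wall_ge h hX; rewrite lerBlDr le_eqVlt => /orP[/eqP eX|lt_X]; last first.
  by apply: num_gf_cool => //; exact: dyadicD.
have le_X := hot_left_wall_ge hs hX; have homo := right_wall_homo X (ltW lt_st).
rewrite -eX; apply: (IHL _ hX _ lt_st).1; lra.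
Qed.

(** * Monotonicity of cooling *)

Definition cool_monotone (t : rat) (G H : game) :=
  (game_ge G H -> game_ge (cool t G) (cool t H)) /\
  (game_gf G H -> game_gf (cool t G) (game_sub (cool t H) (num_game t))).

Lemma cool_monotone_opp t G H : dyadic t ->
  cool_monotone t (game_opp H) (game_opp G) -> cool_monotone t G H.
Proof.
move=> ht [ge gf]; split=> [GH|GH].
  by have := ge; rewrite !cool_opp // !game_ge_opp; apply.
have := gf; rewrite !cool_opp // game_gf_opp => /(_ GH).
by rewrite /game_gf (game_ge_subl (game_opp _)) -game_ge_opp game_oppD !game_oppK.
Qed.

Lemma cool_monotone_integer t G H : dyadic t -> -1 < t -> is_integer_game G ->
  cool_monotone t G H.
Proof.
move=> ht t_gt int; have [_ _ cE] := wallsE_integer t int.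
have /andP[Gn nG] := integer_valueP int; move: (integer_value G) => n in cE Gn nG *.
have [_ _ _ _ [l [r [lE rE geH leH]]]] := walls_regularP H.
have hn := dyadic_int n; rewrite /cool_monotone cE -num_game_int.
split=> [GH|GH].
  have le_ln : l%:~R <= n%:~R :> rat by rewrite ler_int -leH (game_ge_trans nG).
  have := left_wall_anti H (ltW t_gt); rewrite lE => /andP[le_t _].
  (* As [l <= n] and left walls never rise, a tie at [t] means that the wall was flat from -1 on. *)
  have [lt_n|ge_n] := ltP (left_wall t H) n%:~R; first exact: num_ge_cool.
  have eq_n : left_wall t H = n%:~R by lra.
  by rewrite -eq_n; apply: (wall_slope_sign ht H t_gt).2; rewrite lE; lra.
(* Starting from at most [n - 1], over the length [t + 1] the right wall reaches at most [n + t],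
   with a tie only if its slope is 1 throughout. *)
have le_rn : r%:~R <= n%:~R - 1 :> rat.
  have : ~~ (n <= r) by rewrite -geH; apply: contra GH => /game_ge_trans; apply.
  by rewrite -ltNge -(intrB _ n 1) ler_int; lia.
have := right_wall_homo H (ltW t_gt); rewrite rE => /andP[_ le_t].
rewrite /game_gf sub_num_ge //.
have [lt_n|ge_n] := ltP (right_wall t H) (n%:~R + t).
  by apply: num_gf_cool => //; exact: dyadicD.
have eq_n : right_wall t H = n%:~R + t by lra.
by rewrite -eq_n; apply: (wall_slope_sign ht H t_gt).1; rewrite rE; lra.
Qed.

Section InductionStep.
Variables (n : nat) (G H : game).
Hypothesis IH : forall t G' H', dyadic t -> -1 < t -> (rank G' + rank H' < n)%N ->
  cool_monotone t G' H'.
Hypothesis rankGH : (rank G + rank H <= n)%N.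
Variable t : rat.
Hypotheses (ht : dyadic t) (t_gt : -1 < t).

Let IHlG X : X \in lopts G -> cool_monotone t X H.
Proof. by move=> /rank_lopts lt_X; apply: IH => //; lia. Qed.
Let IHrG X : X \in ropts G -> cool_monotone t X H.
Proof. by move=> /rank_ropts lt_X; apply: IH => //; lia. Qed.
Let IHlH X : X \in lopts H -> cool_monotone t G X.
Proof. by move=> /rank_lopts lt_X; apply: IH => //; lia. Qed.
Let IHrH X : X \in ropts H -> cool_monotone t G X.
Proof. by move=> /rank_ropts lt_X; apply: IH => //; lia. Qed.

(** By induction $G_t \ge H^R_t$, and $H^R_t + t$ is a Right option of $H_t$. Only [H] has to be
    hot, so this serves for a frozen [G] too. *)
Lemma gf_cool_ropts : hot t H ->
  (exists2 X, X \in ropts H & game_ge G X) ->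
  game_gf (cool t G) (game_sub (cool t H) (num_game t)).
Proof.
move=> h [X hX /(IHrH hX).1 ge]; apply: game_ge_gf_trans ge _.
have := ropts_gf (cool_ropts h hX); apply: contra.
by rewrite game_ge_subl.
Qed.

Lemma cool_monotone_hot : hot t G -> hot t H -> cool_monotone t G H.
Proof.
move=> hG hH; split=> [GH|/game_gfP[[X hX ge]|]]; last exact: gf_cool_ropts.
  apply/game_geP; split=> Z.
    move=> /(ropts_cool hG)[X hX ->].
    have := (IHrG hX).2 (game_gf_ropts GH hX).
    by rewrite /game_gf game_ge_subl.
  move=> /(lopts_cool hH)[X hX ->].
  exact: (IHlH hX).2 (game_gf_lopts GH hX).
apply/game_gfP; left; exists (game_sub (cool t X) (num_game t)); first exact: cool_lopts.
by rewrite /game_sub game_ge_add2r; exact: (IHlG hX).1.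
Qed.

Lemma cool_monotone_frozen : ~ is_integer_game G -> freezing G < t -> hot t H ->
  cool_monotone t G H.
Proof.
move=> nint lt_z hH.
have nhot : ~ hot t G by case=> _; rewrite leNgt lt_z.
have [eG cE] := not_hotE nhot; have dy := dyadic_left_wall G ht.
have hz : hot (freezing G) G by split.
have yE : left_wall t G = left_wall (freezing G) G.
  have [-> _ _] := wallsE t nint; rewrite leNgt lt_z /=.
  by have [-> _ _] := wallsE (freezing G) nint; rewrite lexx.
split=> [GH|/game_gfP[[X hX ge]|]]; last exact: gf_cool_ropts.
  have opt X : X \in lopts H ->
      game_gf (cool t G) (game_sub (cool t X) (num_game t)).
    by move=> hX; exact: (IHlH hX).2 (game_gf_lopts GH hX).
  rewrite cE in opt *; apply/game_geP; split=> Z; last first.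
    by move=> /(lopts_cool hH)[X /opt + ->].
  move=> /(ropts_num dy)[z [-> _ dz lt_y]].
  (* Otherwise the Left option [X] attaining the left wall of [H] would have its right wall above
     [left_wall t G + t], against [opt]. *)
  have le_y : left_wall t H <= left_wall t G.
    have [X hX ->] := hot_left_tildeP hH; rewrite leNgt; apply/negP => lt.
    have := opt X hX; rewrite /game_gf sub_num_ge // cool_ge_num //.
      exact: dyadicD.
    by lra.
  have lt_mid : left_wall t H < (left_wall t G + z) / 2 by lra.
  have d_mid : dyadic ((left_wall t G + z) / 2) by apply/dyadic_half/dyadicD.
  have := num_ge_cool ht d_mid lt_mid; apply: contraL => Hz; apply/negP => midH.
  by have := game_ge_trans midH Hz; rewrite game_ge_num //; lra.
have XH := (IHlG hX).1 ge; rewrite cE /game_gf sub_num_ge //; apply/negP => Hy.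
have dyt : dyadic (left_wall t G + t) by exact: dyadicD.
have Xy := game_ge_trans XH Hy.
(* At its temperature [G] is still hot, which bounds the right wall of [X] there; rising at most
   with slope 1, it is at most [left_wall t G + t] at [t]. [Xy] gives the reverse bound, so the rise
   is at full slope. *)
have le_y := hot_left_wall_ge hz hX; rewrite -yE in le_y.
have homo := right_wall_homo X (ltW lt_z).
have le_X : left_wall t G + t <= right_wall t X.
  by rewrite leNgt; apply/negP => /(num_gf_cool ht dyt); rewrite /game_gf Xy.
have slope : right_wall t X = right_wall (freezing G) X + (t - freezing G) by lra.
have := (wall_slope_sign ht X lt_z).1 slope.
have -> : right_wall t X = left_wall t G + t by lra.
by rewrite /game_gf Xy.
Qed.

End InductionStep.

(** At least one of the games is hot here; a frozen [H] is reduced to a frozen [G] by negation. *)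
Lemma cool_monotone_le_max n G H t :
  (forall t G' H', dyadic t -> -1 < t -> (rank G' + rank H' < n)%N ->
     cool_monotone t G' H') ->
  (rank G + rank H <= n)%N -> dyadic t -> -1 < t ->
  ~ is_integer_game G -> ~ is_integer_game H ->
  t <= Order.max (freezing G) (freezing H) -> cool_monotone t G H.
Proof.
move=> IH le_n ht t_gt nG nH; rewrite le_max.
have [tG|tG] := leP t (freezing G); have [tH|tH] := leP t (freezing H) => // _.
- exact: (cool_monotone_hot IH).
- apply: cool_monotone_opp => //; apply: (cool_monotone_frozen IH) => //.
  + by rewrite !rank_opp addnC.
  + by rewrite is_integer_gameN.
  + by rewrite freezing_opp.
  + by rewrite hot_opp.
- exact: (cool_monotone_frozen IH).
Qed.

Lemma cool_monotone_nonint n G H t :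
  (forall t G' H', dyadic t -> -1 < t -> (rank G' + rank H' < n)%N ->
     cool_monotone t G' H') ->
  (rank G + rank H <= n)%N -> dyadic t -> -1 < t ->
  ~ is_integer_game G -> ~ is_integer_game H -> cool_monotone t G H.
Proof.
move=> IH le_n ht t_gt nG nH.
have [le_t|] := leP t (Order.max (freezing G) (freezing H)).
  exact: (cool_monotone_le_max IH).
have [dG zG eG _] := freezing_specP nG; have [dH zH eH _] := freezing_specP nH.
move sE : (Order.max _ _) => s lt_st.
have ds : dyadic s by rewrite -sE; case: leP.
have s_gt : -1 < s by rewrite -sE lt_max zG.
have [ge gf] : cool_monotone s G H by apply: (cool_monotone_le_max IH) => //; rewrite sE.
have [sG sH] : freezing G <= s /\ freezing H <= s.
  by rewrite -sE !le_max !lexx orbT.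
(* At [s] both walls of either game already equal its frozen number, although the game cooled by [s]
   may still differ from it by an infinitesimal. *)
have wall K : ~ is_integer_game K -> freezing K <= s ->
    [/\ left_wall s K = left_wall t K, right_wall s K = left_wall t K &
        cool t K = num_game (left_wall t K)].
  move=> nK le_s; have lt_t := le_lt_trans le_s lt_st; have [_ _ zE _] := freezing_specP nK.
  have [-> _ ->] := wallsE t nK; rewrite leNgt lt_t /=.
  have [-> -> _] := wallsE s nK; case: ifP => // le_z.
  by have -> : s = freezing K by lra.
have [lG rG cG] := wall G nG sG; have [lH rH cH] := wall H nH sH.
rewrite /cool_monotone cG cH; move: (left_wall t G) (left_wall t H) lG lH rG rH => x y.
move=> lG lH rG rH; have dx : dyadic x by rewrite -lG; exact: dyadic_left_wall.
have dy : dyadic y by rewrite -lH; exact: dyadic_left_wall.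
split=> [/ge GH|/gf GH].
  rewrite game_ge_num // leNgt; apply/negP => lt_xy.
  (* A number strictly between the walls absorbs these infinitesimals. *)
  have dz : dyadic ((x + y) / 2) by apply/dyadic_half/dyadicD.
  have: game_gf (cool s H) (num_game ((x + y) / 2)) by apply: cool_gf_num => //; lra.
  by apply/negP/negPn; apply: game_ge_trans GH; apply: num_ge_cool => //; lra.
have dyt : dyadic (y - t) by exact: dyadicB.
rewrite /game_gf game_ge_subl game_ge_num_addr // game_ge_num //; last exact: dyadicD.
rewrite -ltNge ltNge; apply/negP => le_xy.
(* Since [s < t], the assumed [x <= y - t] puts [x] strictly below [y - s], which leaves room for a
   separating number. *)
have dz : dyadic ((x + (y - s)) / 2) by apply/dyadic_half/dyadicD/dyadicB.
move: GH; apply/negP/negPn.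
apply: (@game_ge_trans (num_game ((x + (y - s)) / 2))); last by apply: num_ge_cool => //; lra.
by rewrite sub_num_ge //; apply: cool_ge_num => //; [exact: dyadicD | lra].
Qed.

(** The induction is on the sum of the ranks with [t] quantified, because the case of two frozen
    games uses the hypothesis at the larger temperature instead of [t]. *)
Lemma cool_monotoneP t G H : dyadic t -> -1 < t -> cool_monotone t G H.
Proof.
have [n] := ubnP (rank G + rank H)%N; elim: n t G H => // n IH t G H lt_n ht t_gt.
have [int|nG] := pselect (is_integer_game G); first exact: cool_monotone_integer.
have [int|nH] := pselect (is_integer_game H).
  apply: cool_monotone_opp => //; apply: cool_monotone_integer => //.
  by rewrite is_integer_gameN.
by apply: (@cool_monotone_nonint n) => // s G' H' *; apply: IH.
Qed.

Unset Implicit Arguments.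

Theorem theorem11 (t : rat) (ht : dyadic t) (t_gt : -1 < t) (G H : game) :
  (game_ge G H -> game_ge (cool t G) (cool t H)) /\
  (game_gf G H -> game_gf (cool t G) (game_sub (cool t H) (num_game t))).
Proof. exact: cool_monotoneP. Qed.
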